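(* Let $A\in\mathrm{Sym}(n,\mathbb{R})$ be a sufficiently generic real symmetric matrix. Then the $\binom n2$ real critical points $C^T\Lambda_{i,j}C$ ($1\le i<j\le n$) of $d_A:\mathscr{C}(\Delta_{\mathrm{sm}})\to\mathbb{R}$ are the only ED critical points of $A$ with respect to $\mathscr{C}(\Delta)$, and the Euclidean distance degree satisfies $\mathrm{EDdeg}(\mathscr{C}(\Delta))=\binom n2$.
   Context: $\mathrm{Sym}(n,\mathbb{R})$ (resp. $\mathrm{Sym}(n,\mathbb{C})$) is the space of real (resp. complex) symmetric $n\times n$ matrices, with the bilinear form $(A_1,A_2)\mapsto\mathrm{tr}(A_1^TA_2)$ and norm $\|Q\|=\sqrt{\mathrm{tr}(Q^2)}$ on the real space. $\mathscr{C}(\Delta)\subset\mathrm{Sym}(n,\mathbb{R})$ is the real algebraic variety of real symmetric matrices with a repeated eigenvalue, $\mathscr{C}(\Delta_{\mathrm{sm}})$ the set of those with exactly one double eigenvalue and all other eigenvalues simple, and $X^{\mathbb{C}}\subset\mathrm{Sym}(n,\mathbb{C})$ the Zariski closure of $\mathscr{C}(\Delta)$, with smooth locus $X^{\mathbb{C}}_{\mathrm{sm}}$. For $A=C^T\Lambda C$ a spectral decomposition with $\Lambda=\mathrm{diag}(\lambda_1,\dots,\lambda_n)$, $\Lambda_{i,j}$ is $\Lambda$ with its $i$-th and $j$-th diagonal entries replaced by $\frac{\lambda_i+\lambda_j}2$. An ED critical point of $A$ with respect to $\mathscr{C}(\Delta)$ is a point $x\in X^{\mathbb{C}}_{\mathrm{sm}}$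 with $A-x$ orthogonal to $T_xX^{\mathbb{C}}_{\mathrm{sm}}$ with respect to the bilinear form above; $\mathrm{EDdeg}(\mathscr{C}(\Delta))$ is the number of such points for generic $A$. *)

(* Defs.v *)
From HB Require Import structures.
From mathcomp Require Import all_boot all_order all_algebra.
From mathcomp Require Import mpoly.
From mathcomp Require Import complex.
From mathcomp Require Import reals.

Set Implicit Arguments.
Unset Strict Implicit.
Unset Printing Implicit Defensive.

Import Order.TTheory GRing.Theory Num.Theory.
Local Open Scope ring_scope.

Section EDDefs.
Variable R : realType.
Local Notation C := (R : rcfType)[i].

Definition coords (T : Type) (n : nat) (X : 'M[T]_n) : 'I_(n * n) -> T :=
  fun k => mxvec X 0 k.

Definition mxC (n : nat) (A : 'M[R]_n) : 'M[C]_n := map_mx (real_complex R) A.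

Definition in_Cdelta (n : nat) (A : 'M[R]_n) : Prop :=
  A^T = A /\ exists l : R, (('X - l%:P) ^+ 2 %| char_poly A)%R.

Definition vanishes_on_Cdelta (n : nat) (p : {mpoly C[n * n]}) : Prop :=
  forall A : 'M[R]_n, in_Cdelta A -> p.@[coords (mxC A)] = 0.

(* X^C : the Zariski closure of C(Delta) in the complex matrices
   (it is contained in Sym(n,C) since x_ij - x_ji vanishes on C(Delta)) *)
Definition in_XC (n : nat) (x : 'M[C]_n) : Prop :=
  forall p, vanishes_on_Cdelta p -> p.@[coords x] = 0.

Definition tangent_XC (n : nat) (x v : 'M[C]_n) : Prop :=
  forall p, vanishes_on_Cdelta p ->
    \sum_(k < n * n) (p^`M(k)).@[coords x] * coords v k = 0.

Definition lin_indep (n d : nat) (B : 'I_d -> 'M[C]_n) : Prop :=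
  forall c : 'I_d -> C, \sum_(i < d) c i *: B i = 0 -> forall i, c i = 0.

Definition subspace_dim (n : nat) (S : 'M[C]_n -> Prop) (d : nat) : Prop :=
  (exists B : 'I_d -> 'M[C]_n, (forall i, S (B i)) /\ lin_indep B) /\
  (forall (d' : nat) (B : 'I_d' -> 'M[C]_n),
      (forall i, S (B i)) -> lin_indep B -> (d' <= d)%N).

Definition alg_indep_vars (n : nat) (S : {set 'I_(n * n)}) : Prop :=
  forall p : {mpoly C[n * n]}, vanishes_on_Cdelta p ->
    (forall m, m \in msupp p -> forall k, k \notin S -> m k = 0%N) -> p = 0.

(* dimension of X^C (Krull dimension of its coordinate ring) *)
Definition XC_dim (n d : nat) : Prop :=
  (exists S : {set 'I_(n * n)}, #|S| = d /\ alg_indep_vars S) /\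
  (forall S : {set 'I_(n * n)}, alg_indep_vars S -> (#|S| <= d)%N).

Definition in_XC_sm (n : nat) (x : 'M[C]_n) : Prop :=
  in_XC x /\ exists d, XC_dim n d /\ subspace_dim (tangent_XC x) d.

Definition ED_critical (n : nat) (A : 'M[R]_n) (x : 'M[C]_n) : Prop :=
  in_XC_sm x /\
  forall v, tangent_XC x v -> \tr ((mxC A - x)^T *m v) = 0.

Definition generic_sym (n : nat) (P : 'M[R]_n -> Prop) : Prop :=
  exists g : {mpoly R[n * n]},
    (exists A0 : 'M[R]_n, A0^T = A0 /\ g.@[coords A0] != 0) /\
    forall A : 'M[R]_n, A^T = A -> g.@[coords A] != 0 -> P A.

Definition EDdeg_is (n d : nat) : Prop :=
  generic_sym (fun A : 'M[R]_n =>
    exists s : seq 'M[C]_n, uniq s /\ size s = d /\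
      forall x, ED_critical A x <-> x \in s).

Definition Lambda_ij (n : nat) (l : 'rV[R]_n) (i j : 'I_n) : 'rV[R]_n :=
  \row_k (if (k == i) || (k == j) then (l 0 i + l 0 j) / 2 else l 0 k).

End EDDefs.

(* Main.v *)
Require Import Defs.
From HB Require Import structures.
From mathcomp Require Import all_boot all_order all_algebra.
From mathcomp Require Import mpoly.
From mathcomp Require Import complex.
From mathcomp Require Import reals.
From mathcomp Require Import fingroup perm.
From mathcomp Require boolp.
From mathcomp Require Import ring lra zify.
Import Order.TTheory GRing.Theory Num.Theory.
Local Open Scope ring_scope.
Set Implicit Arguments.
Unset Strict Implicit.
Unset Printing Implicit Defensive.

(** Conjugation by real orthogonal matrices preserves the Zariski closure X of the matrices
    with a repeated eigenvalue, so T_x X contains [E, x] for every skew E.  If A - x is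
    orthogonal to T_x X, then x commutes with A; in an eigenbasis of A, x = diag mu.  Since
    x is in X, mu_i = mu_j for some i <> j, and X contains all the diagonal matrices with
    this property; orthogonality to them forces x = Lambda_ij.

    Conversely, for a real symmetric A with a repeated eigenvalue the powers of A span a
    space of dimension less than n, so the n x n minors of the family of polynomials in A
    vanish on X.  At diag mu with a single double eigenvalue mu_i = mu_j these minors cut out
    v_ij = 0, v_ii = v_jj, so the tangent space has codimension 2 in the symmetric matrices.
    This is also the codimension of X: the polynomial map (W, P, lam) |-> [W|1]^T P [W|1] + lam
    is dominant onto X, which bounds the dimension from above by counting monomials, and a
    generic choice of all upper triangular entries but two extends to a matrix of X. *)

(** * Polynomials in several variables *)

(** A nonzero polynomial has fewer roots than its size. Natural numbers are convenient test points
    because they are real as well as complex: at them, matrices stay real. *)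
Lemma poly_nat_roots (D : idomainType) (u : {poly D}) :
  injective (fun k : nat => k%:R : D) -> (forall k : nat, u.[k%:R] = 0) -> u = 0.
Proof.
move=> injn u0; apply/eqP/negPn/negP => nzu.
have := max_poly_roots (rs := [seq k%:R | k <- iota 0 (size u)]) nzu.
rewrite map_inj_uniq // iota_uniq size_map size_iota ltnn => H.
suff: false by []; apply: H => //.
by apply/allP => _ /mapP[k _ ->]; rewrite /root u0.
Qed.

Lemma rmorph_mmap (n : nat) (A : nzRingType) (B B' : comNzRingType)
    (phi : {rmorphism B -> B'}) (f : {rmorphism A -> B}) (h : 'I_n -> B) (p : {mpoly A[n]}) :
  phi (mmap f h p) = mmap (phi \o f) (phi \o h) p.
Proof.
rewrite /mmap rmorph_sum; apply: eq_bigr => m _; rewrite rmorphM /mmap1 rmorph_prod.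
by congr (_ * _); apply: eq_bigr => i _; rewrite rmorphXn.
Qed.

Lemma eq_mmap (n : nat) (A B : nzRingType) (f f' : A -> B) (h h' : 'I_n -> B)
    (p : {mpoly A[n]}) :
  f =1 f' -> h =1 h' -> mmap f h p = mmap f' h' p.
Proof.
move=> ff' hh'; apply: eq_bigr => m _; rewrite ff'; congr (_ * _).
exact: mmap1_eq.
Qed.

(* The variables are freed one at a time: at each step the partial evaluation is
   a univariate polynomial with infinitely many roots. *)
Lemma mpoly_nat_eq0 (F : numDomainType) (n : nat) (p : {mpoly F[n]}) :
  (forall v : 'I_n -> nat, p.@[fun i => (v i)%:R] = 0) -> p = 0.
Proof.
move=> p0.
pose h (k : nat) (v : 'I_n -> nat) (i : 'I_n) : {mpoly F[n]} :=
  if (i < k)%N then 'X_i else (v i)%:R.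
have Q k : (k <= n)%N -> forall v, mmap (@mpolyC n F) (h k v) p = 0.
  elim: k => [_ v|k IH ltkn v].
    rewrite (@eq_mmap _ _ _ _ (@mpolyC n F \o idfun) _
              (@mpolyC n F \o (fun i => (v i)%:R))) //; last first.
      by move=> i; rewrite /h /= mpolyC_nat.
    by rewrite -rmorph_mmap -[mmap _ _ _]/(p.@[_]) p0 raddf0.
  (* Variable [k] becomes a univariate indeterminate over the multivariate ring. The resulting [u]
     is zero, and its value at ['X_k] is the next stage. *)
  pose g (i : 'I_n) : {poly {mpoly F[n]}} :=
    if i == k :> nat then 'X else (h k v i)%:P.
  pose u : {poly {mpoly F[n]}} := mmap (polyC \o @mpolyC n F) g p.
  have uE x : u.[x] = mmap (@mpolyC n F)
      (fun i => if i == k :> nat then x else h k v i) p.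
    rewrite -/(horner_eval x u) /u rmorph_mmap; apply: eq_mmap => [c|i] /=.
      by rewrite /horner_eval hornerC.
    by rewrite /g /horner_eval; case: eqP; rewrite ?hornerX ?hornerC.
  have u0 : u = 0.
    apply: poly_nat_roots => [a b|t].
      rewrite -!mpolyC_nat => /(congr1 (mcoeff 0%MM)).
      by rewrite !mcoeffC !eqxx !mulr1 => /eqP; rewrite eqr_nat => /eqP.
    rewrite uE -[RHS](IH (ltnW ltkn) (fun i => if i == k :> nat then t else v i)).
    apply: eq_mmap => // i; rewrite /h.
    by case: eqP => // ->; rewrite ltnn.
  have := uE 'X_(Ordinal ltkn); rewrite u0 horner0 => /esym e.
  rewrite -[RHS]e; apply: eq_mmap => // i; rewrite /h ltnS.
  case: eqP => [ik|/eqP nik].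
    by rewrite ik leqnn; congr ('X_ _); apply: val_inj.
  by rewrite [(i <= k)%N]leq_eqVlt (negbTE nik).
rewrite -[LHS](comp_mpoly_id p) -[RHS](Q n (leqnn n) (fun=> 0%N)).
apply: eq_mmap => // i; by rewrite tnth_map tnth_ord_tuple /h ltn_ord.
Qed.

(** The chain rule along a polynomial curve: the polynomials obeying it contain the constants and
    the variables and are closed under sums and products. *)
Lemma deriv_mmap (F : comNzRingType) (n : nat) (h : 'I_n -> {poly F}) (p : {mpoly F[n]}) :
  (mmap polyC h p)^`() = \sum_(k < n) mmap polyC h p^`M(k) * (h k)^`().
Proof.
pose chain (q : {mpoly F[n]}) :=
  (mmap polyC h q)^`() = \sum_(k < n) mmap polyC h q^`M(k) * (h k)^`().
have chainD q r : chain q -> chain r -> chain (q + r).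
  rewrite /chain => cq cr; rewrite rmorphD derivD cq cr -big_split; apply: eq_bigr => k _.
  by rewrite mderivD rmorphD mulrDl.
have chainM q r : chain q -> chain r -> chain (q * r).
  rewrite /chain => cq cr; rewrite rmorphM derivM cq cr mulr_suml mulr_sumr -big_split.
  by apply: eq_bigr => k _; rewrite mderivM rmorphD !rmorphM /=; ring.
have chainC c : chain c%:MP.
  rewrite /chain mmapC derivC big1 // => k _.
  by rewrite mderivC raddf0 mul0r.
have chainX i : chain 'X_i.
  rewrite /chain mmapX mmap1U (bigD1 i) //= big1 => [|k ki].
    by rewrite mderivX mnm1E eqxx scale1r -[X in (X - _)%MM]add0m addmK mpolyX0 rmorph1 mul1r addr0.
  by rewrite mderivX mnm1E eq_sym (negbTE ki) scale0r raddf0 mul0r.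
rewrite -/(chain p).
elim/mpolyind: p => [|c m p _ _ IH]; first by rewrite -mpolyC0; exact: chainC.
apply: (chainD) => //; rewrite -mul_mpolyC; apply: (chainM) => //.
rewrite mpolyXE_id; elim/big_rec: _ => [|i q _ cq]; first by rewrite -mpolyC1.
apply: (chainM) => //; elim: (m i) => [|k IHk]; first by rewrite expr0 -mpolyC1.
by rewrite exprS; apply: chainM.
Qed.

(* Counting monomials: over the box of exponents bounded by D there are about D^#|S|
   monomials in the variables S, but only O(D^#|S0|) available in the images. *)
Lemma mpoly_alg_dep (F : fieldType) (N : nat) (psi : 'I_N -> {mpoly F[N]})
    (S S0 : {set 'I_N}) :
  (forall i m, m \in msupp (psi i) -> forall k, k \notin S0 -> m k = 0%N) ->
  (#|S0| < #|S|)%N ->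
  exists p : {mpoly F[N]}, [/\ p != 0,
    (forall m, m \in msupp p -> forall k, k \notin S -> m k = 0%N) &
    mmap (@mpolyC N F) psi p = 0].
Proof.
move=> psiS0 ltS.
pose e := \max_(i < N) msize (psi i).
pose bnd d (q : {mpoly F[N]}) := forall m, m \in msupp q ->
  (mdeg m <= d)%N /\ forall k, k \notin S0 -> m k = 0%N.
have bndM d d' q r : bnd d q -> bnd d' r -> bnd (d + d')%N (q * r).
  move=> bq br m /msuppM_le /allpairsP[[m1 m2] /= [/bq[d1 s1] /br[d2 s2] ->]].
  split=> [|k kS]; first by rewrite mdegD leq_add.
  by rewrite mnmDE s1 // s2.
have bnd1 : bnd 0%N 1.
  by move=> m; rewrite msupp1 inE => /eqP ->; split=> [|k _]; rewrite ?mdeg0 ?mnm0E.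
have bndpsi i : bnd e (psi i).
  move=> m mi; split; last exact: psiS0 mi.
  have /ltnW le := msize_mdeg_lt mi; apply: leq_trans le _.
  exact: (leq_bigmax i).
have bndX m : bnd (e * mdeg m)%N (mmap1 psi m).
  rewrite mdegE big_distrr /= /mmap1.
  elim/big_rec2: _ => [|i q d _ bq]; first exact: bnd1.
  apply: (bndM) => //; elim: (m i) => [|k IHk]; first by rewrite muln0 expr0.
  by rewrite exprS mulnS; apply: bndM.
(* With [s0 = #|S0|], these constants give (E+1)^s0 <= (K(D+1))^s0 = D (D+1)^s0 < (D+1)^(s0+1), so
   the source box is larger than the target box. *)
pose K := (e * N).+1.
pose D := (K ^ #|S0|)%N.
pose E := (e * (N * D))%N.
pose box (d : nat) (T : {set 'I_N}) :=
  [set f : {ffun 'I_N -> 'I_d.+1} | f \in pffun_on ord0 (mem T) predT].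
have boxP d (T : {set 'I_N}) (f : {ffun 'I_N -> 'I_d.+1}) :
    reflect (forall k, k \notin T -> f k = ord0) (f \in box d T).
  rewrite inE; apply: (iffP pffun_onP) => [[sub _] k kT|f0].
    apply: contraNeq kT => fk; have /subsetP/(_ k) := sub.
    by apply.
  split=> //; apply/subsetP => k fk; apply: contraNT fk => /f0 fk0.
  by rewrite fk0 eqxx.
have card_box d (T : {set 'I_N}) : #|box d T| = (d.+1 ^ #|T|)%N.
  rewrite cardsE card_pffun_on.
  by congr (_ ^ _)%N; rewrite -[RHS]card_ord; apply: eq_card.
pose mn d (f : {ffun 'I_N -> 'I_d.+1}) : 'X_{1..N} := [multinom (f i : nat) | i < N].
have mnE d (f : {ffun 'I_N -> 'I_d.+1}) i : mn d f i = f i by rewrite mnmE.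
pose src (i : 'I_#|box D S|) := mn D (enum_val i).
pose tgt (j : 'I_#|box E S0|) := mn E (enum_val j).
have src_inj : injective src.
  move=> i i' /mnmP eqi; apply/enum_val_inj/ffunP => k; apply: val_inj.
  by have := eqi k; rewrite !mnE.
(* Row [i] holds the coefficients of the image of the [i]-th source monomial, so a left kernel
   vector is the coefficient vector of a relation. *)
pose A := \matrix_(i, j) (mmap1 psi (src i))@_(tgt j).
have ltc : (#|box E S0| < #|box D S|)%N.
  rewrite !card_box.
  apply: (@leq_ltn_trans ((K * D.+1) ^ #|S0|)%N).
    have le : (E.+1 <= K * D.+1)%N by rewrite /E /K; nia.
    by have [->|s0] := posnP #|S0|; rewrite ?expn0 // leq_exp2r.
  rewrite expnMn; apply: (@leq_trans (D.+1 * D.+1 ^ #|S0|)%N).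
    by rewrite ltn_mul2r expn_gt0 /= ltnS.
  by rewrite -expnS leq_pexp2l.
have : kermx A != 0.
  rewrite -mxrank_eq0 mxrank_ker -lt0n subn_gt0.
  exact: leq_ltn_trans (rank_leq_col A) ltc.
case/rowV0Pn => u /sub_kermxP uA nzu.
pose p := \sum_i u 0 i *: 'X_[src i] : {mpoly F[N]}.
have pE i : p@_(src i) = u 0 i.
  rewrite raddf_sum (bigD1 i) //= mcoeffZ mcoeffX eqxx mulr1 big1 ?addr0 // => j ji.
  by rewrite mcoeffZ mcoeffX (inj_eq src_inj) (negbTE ji) mulr0.
exists p; split.
- apply: contraNneq nzu => p0; apply/eqP/rowP => i.
  by rewrite -pE p0 mcoeff0 mxE.
- move=> m /msupp_sum_le /flattenP[s /mapP[i _ ->]] /msuppZ_le.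
  rewrite msuppX inE => /eqP -> k kS.
  by rewrite mnE; have /boxP -> := enum_valP i.
- apply/mpolyP => m; rewrite mcoeff0 (rmorph_sum (mmap (@mpolyC N F) psi)) /= raddf_sum /=.
  under eq_bigr do rewrite mmapZ mmapX mul_mpolyC mcoeffZ.
  have [/existsP[f /andP[fb /eqP ->]]|nex] := boolP [exists f in box E S0, m == mn E f].
    have /rowP/(_ (enum_rank_in fb f)) := uA.
    rewrite mxE [RHS]mxE => uA0; rewrite -[RHS]uA0; apply: eq_bigr => i _.
    by rewrite mxE /tgt enum_rankK_in.
  apply: big1 => i _; apply/eqP; rewrite mulf_eq0 orbC mcoeff_eq0.
  apply/orP; left; apply: contra nex => /bndX[dm sm].
  have mE k : (m k < E.+1)%N.
    rewrite ltnS; apply: (@leq_trans (mdeg m)).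
      by rewrite mdegE (bigD1 k) //= leq_addr.
    apply: leq_trans dm _; rewrite leq_mul2l; apply/orP; right.
    rewrite mdegE -[N in (N * D)%N]card_ord -sum_nat_const; apply: leq_sum => j _.
    by rewrite mnE -ltnS.
  apply/existsP; exists [ffun k => Ordinal (mE k)].
  apply/andP; split.
    by apply/boxP => k /sm mk; rewrite ffunE; apply: val_inj.
  by apply/eqP/mnmP => k; rewrite mnE ffunE.
Qed.

(** * The real spectral theorem *)

Section RealSpectral.
Variable R : rcfType.
Local Notation C := R[i].

Lemma sqrmx_eq0 (n : nat) (u : 'rV[R]_n) : (u *m u^T) 0 0 = 0 -> u = 0.
Proof.
rewrite mxE => /eqP; under eq_bigr do rewrite mxE -expr2.
rewrite psumr_eq0 => [/allP u0|i _]; last exact: sqr_ge0.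
by apply/rowP => i; have := u0 i (mem_index_enum i); rewrite sqrf_eq0 mxE => /eqP.
Qed.

(* For a complex eigenvector vr + i vi, comparing vr A vi^T with its transpose gives
   Im a (|vr|^2 + |vi|^2) = 0. *)
Lemma sym_real_eigen (n : nat) (A : 'M[R]_n.+1) : A^T = A ->
  exists (a : R) (u : 'rV[R]_n.+1), u != 0 /\ u *m A = a *: u.
Proof.
move=> symA; pose Ac := map_mx (real_complex R) A.
have [a ea] : exists a : C, root (char_poly Ac) a.
  by apply/closed_rootP; rewrite size_char_poly.
have /eigenvalueP[v vA nzv] : eigenvalue Ac a by rewrite eigenvalue_root_char.
pose vr := map_mx (@complex.Re R) v; pose vi := map_mx (@complex.Im R) v.
have ReA i j : \sum_k v i k * Ac k j = a * v i j.
  by have /matrixP/(_ i j) := vA; rewrite !mxE.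
have eR : vr *m A = complex.Re a *: vr - complex.Im a *: vi.
  apply/matrixP => i j; have := congr1 (@complex.Re R) (ReA i j).
  rewrite raddf_sum /= !mxE; case: (a) (v i j) => [ar ai] [br bi] /= <-.
  apply: eq_bigr => k _; rewrite !mxE; case: (v i k) => x y /=; ring.
have eI : vi *m A = complex.Im a *: vr + complex.Re a *: vi.
  apply/matrixP => i j; have := congr1 (@complex.Im R) (ReA i j).
  rewrite raddf_sum /= !mxE; case: (a) (v i j) => [ar ai] [br bi] /= e.
  transitivity (ar * bi + ai * br); last by ring.
  rewrite -e; apply: eq_bigr => k _; rewrite !mxE; case: (v i k) => x y /=; ring.
have nz : (vr != 0) || (vi != 0).
  apply: contraNT nzv; rewrite negb_or !negbK => /andP[/eqP vr0 /eqP vi0].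
  apply/eqP/matrixP => i j; have /matrixP/(_ i j) := vr0; have /matrixP/(_ i j) := vi0.
  by rewrite !mxE; case: (v i j) => x y /= -> ->.
have sc (x y : 'rV[R]_n.+1) : (x *m y^T) 0 0 = (y *m x^T) 0 0.
  by rewrite -[x *m _]trmxK trmx_mul trmxK mxE.
have a0 : complex.Im a = 0.
  have : (vr *m A *m vi^T) 0 0 = (vi *m A *m vr^T) 0 0.
    by rewrite sc trmx_mul symA mulmxA.
  rewrite eR eI mulmxBl mulmxDl -!scalemxAl => e.
  have dE (x y : 'rV[R]_n.+1) : (x *m y^T) 0 0 = \sum_k x 0 k * y 0 k.
    by rewrite mxE; apply: eq_bigr => k _; rewrite mxE.
  pose q (x : 'rV[R]_n.+1) := (x *m x^T) 0 0.
  have q0 x : 0 <= q x.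
    by rewrite /q dE sumr_ge0 // => k _; rewrite -expr2 sqr_ge0.
  have : complex.Im a * (q vr + q vi) = 0.
    have eZ b (M : 'M[R]_1) : (b *: M) 0 0 = b * M 0 0 by rewrite mxE.
    have eN (M : 'M[R]_1) : (- M) 0 0 = - M 0 0 by rewrite mxE.
    have eD (M M' : 'M[R]_1) : (M + M') 0 0 = M 0 0 + M' 0 0 by rewrite mxE.
    move: e; rewrite !(eD, eN, eZ) (sc vi vr) -!/(q _) => e; rewrite mulrDr.
    lra.
  move/eqP; rewrite mulf_eq0 => /orP[/eqP //|].
  rewrite paddr_eq0 // => /andP[/eqP /sqrmx_eq0 r0 /eqP /sqrmx_eq0 i0].
  by move: nz; rewrite r0 i0 eqxx.
case/orP: nz => nz; [exists (complex.Re a), vr|exists (complex.Re a), vi]; split=> //.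
  by rewrite eR a0 scale0r subr0.
by rewrite eI a0 scale0r add0r.
Qed.

(* The Householder reflection exchanging u and the first basis vector. *)
Lemma orthomx_first_row (n : nat) (u : 'rV[R]_n.+1) : u *m u^T = 1%:M ->
  exists H : 'M[R]_n.+1, H *m H^T = 1%:M /\ row 0 H = u.
Proof.
move=> uu; have [w wE] : exists w, w = delta_mx 0 0 - u by eexists.
have [w0|nzw] := eqVneq w 0.
  exists 1%:M; rewrite trmx1 mulmx1; split=> //.
  by rewrite row1; apply/eqP; rewrite -subr_eq0 -wE w0.
pose s := (w *m w^T) 0 0.
have nzs : s != 0 by apply: contra_neq nzw => /sqrmx_eq0.
have wwE : w *m w^T = s%:M by rewrite [LHS]mx11_scalar.
have eu : s = 2 * (1 - u 0 0).
  rewrite /s wE linearB /= mulmxBl !mulmxBr uu trmx_delta mul_delta_mx.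
  rewrite -rowE -[u *m _]trmxK trmx_mul trmx_delta -rowE !mxE !eqxx /=; ring.
pose H := 1%:M - (2 / s) *: (w^T *m w).
have HT : H^T = H by rewrite linearB /= trmx1 linearZ /= trmx_mul trmxK.
exists H; split.
  rewrite HT /H mulmxBl mul1mx mulmxBr mulmx1 -!scalemxAl -!scalemxAr.
  rewrite mulmxA -(mulmxA w^T) wwE mul_mx_scalar -scalemxAl !scalerA.
  have -> : 2 / s * (2 / s * s) = 2 / s + 2 / s by field.
  by rewrite scalerDl opprB addrK subrK.
rewrite rowE mulmxBr mulmx1 -scalemxAr mulmxA -[delta_mx 0 0 *m w^T]trmxK.
rewrite trmx_mul trmxK trmx_delta -colE [col 0 w]mx11_scalar tr_scalar_mx mul_scalar_mx.
rewrite scalerA wE !mxE !eqxx /= eu.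
have nz1 : 1 - u 0 0 != 0 by move: nzs; rewrite eu mulf_eq0 negb_or => /andP[].
have -> : 2 / (2 * (1 - u 0 0)) * (1 - u 0 0) = 1 by field.
by rewrite scale1r opprB addrC subrK.
Qed.

(** Induction on the size: a reflection whose first row is a unit eigenvector makes the first row of
    the conjugate a multiple of the first basis vector; by symmetry the conjugate is block
    diagonal. *)
Lemma real_spectral (n : nat) (A : 'M[R]_n) : A^T = A ->
  exists (Q : 'M[R]_n) (l : 'rV[R]_n), Q^T *m Q = 1%:M /\ A = Q^T *m diag_mx l *m Q.
Proof.
elim: n A => [|n IH] A symA.
  by exists 1%:M, 0; split; apply/matrixP => - [].
have [a [v [nzv vA]]] := sym_real_eigen symA.
pose s := (v *m v^T) 0 0.
have s_gt0 : 0 < s.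
  rewrite lt0r; apply/andP; split; first by apply: contra_neq nzv => /sqrmx_eq0.
  by rewrite /s mxE sumr_ge0 // => k _; rewrite mxE -expr2 sqr_ge0.
pose u := (Num.sqrt s)^-1 *: v.
have uu : u *m u^T = 1%:M.
  rewrite linearZ /= -scalemxAl -scalemxAr scalerA [v *m _]mx11_scalar -/s.
  rewrite -mul_scalar_mx -scalar_mxM -expr2 exprVn sqr_sqrtr ?ltW //.
  by rewrite mulVf ?gt_eqF.
have uA : u *m A = a *: u by rewrite -scalemxAl vA scalerA mulrC -scalerA.
have [H [HH rH]] := orthomx_first_row uu.
have HTH : H^T *m H = 1%:M by apply: mulmx1C.
have [B BH] : exists B : 'M[R]_(1 + n), B = H *m A *m H^T by eexists.
have symB : B^T = B by rewrite BH !trmx_mul trmxK symA mulmxA.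
have rB : row 0 B = a *: delta_mx 0 0.
  by rewrite BH !row_mul rH uA -scalemxAl -rH -row_mul HH row1.
have urB : ursubmx B = 0.
  apply/matrixP => i j; have /rowP/(_ (rshift 1 j)) := rB.
  rewrite !mxE ord1 (_ : lshift n 0 = 0) => [->|]; last exact: val_inj.
  by rewrite mulr0.
have [Q [l [QQ BE]]] : exists (Q : 'M[R]_n) (l : 'rV[R]_n),
    Q^T *m Q = 1%:M /\ drsubmx B = Q^T *m diag_mx l *m Q.
  by apply: IH; rewrite trmx_drsub symB.
have dlB : dlsubmx B = 0 by rewrite -symB -trmx_ursub urB trmx0.
have eB : B = block_mx (ulsubmx B) 0 0 (drsubmx B) by rewrite -[LHS]submxK urB dlB.
pose T : 'M[R]_(1 + n) := block_mx 1%:M 0 0 Q.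
have TT : T^T *m T = 1%:M.
  rewrite /T tr_block_mx mulmx_block !trmx0 trmx1.
  by rewrite !(mulmx0, mul0mx, mulmx1, addr0, add0r) QQ -scalar_mx_block.
have TB : B = T^T *m diag_mx (row_mx (ulsubmx B) l) *m T.
  rewrite {1}eB BE diag_mx_row /T tr_block_mx !mulmx_block !trmx0 trmx1.
  rewrite !(mulmx0, mul0mx, mulmx1, mul1mx, addr0, add0r).
  by congr block_mx; apply/matrixP => i j; rewrite !ord1 [RHS]mxE eqxx mulr1n.
exists (T *m H), (row_mx (ulsubmx B) l); split.
  by rewrite trmx_mul mulmxA -(mulmxA H^T) TT mulmx1.
have -> : A = H^T *m B *m H.
  by rewrite BH !mulmxA HTH mul1mx -mulmxA HTH mulmx1.
by rewrite {1}TB trmx_mul !mulmxA.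
Qed.
End RealSpectral.

(** * The Zariski closure and polynomial curves *)

Lemma char_poly_orth (F : fieldType) (n : nat) (Q : 'M[F]_n) (l : 'rV[F]_n) :
  Q^T *m Q = 1%:M -> char_poly (Q^T *m diag_mx l *m Q) = \prod_k ('X - (l 0 k)%:P).
Proof.
move=> QQ; pose P := map_mx (@polyC F) Q.
have PP : P^T *m P = 1%:M by rewrite /P map_trmx -map_mxM QQ map_mx1.
have -> : char_poly (Q^T *m diag_mx l *m Q) = char_poly (diag_mx l).
  rewrite /char_poly /char_poly_mx.
  have -> : 'X%:M - map_mx polyC (Q^T *m diag_mx l *m Q) =
            P^T *m ('X%:M - map_mx polyC (diag_mx l)) *m P.
    rewrite mulmxBr mulmxBl mul_mx_scalar -scalemxAl PP scalemx1 !map_mxM -map_trmx.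
    by [].
  rewrite !det_mulmx mulrAC -det_mulmx PP det1 mul1r //.
rewrite char_poly_trig ?diag_mx_is_trig //.
by apply: eq_bigr => k _; rewrite mxE eqxx mulr1n.
Qed.

(** The matrix of coordinate functions: a matrix expression in it has as entries the polynomials
    that compute this expression at every point. *)
Definition generic_mx (F : comNzRingType) (n : nat) : 'M[{mpoly F[n * n]}]_n :=
  vec_mx (\row_k 'X_k).

Lemma map_generic_mx (F : comNzRingType) (n : nat) (x : 'M[F]_n) :
  map_mx (meval (coords x)) (generic_mx F n) = x.
Proof.
rewrite /generic_mx -(mxvecK x) map_vec_mx; congr vec_mx.
by apply/rowP => k; rewrite !mxE mevalXU mxvecK.
Qed.

Lemma mmap_generic_mx (F B : comNzRingType) (n : nat) (f : {rmorphism F -> B}) (Y : 'M[B]_n) :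
  map_mx (mmap f (coords Y)) (generic_mx F n) = Y.
Proof.
rewrite /generic_mx -[RHS](mxvecK Y) map_vec_mx; congr vec_mx.
by apply/rowP => k; rewrite !mxE mmapX mmap1U.
Qed.

Lemma map_coords (n : nat) (A B : Type) (f : A -> B) (X : 'M[A]_n) k :
  f (coords X k) = coords (map_mx f X) k.
Proof. by rewrite /coords -map_mxvec mxE. Qed.

Section Closure.
Variables (R : realType) (n : nat).
Local Notation C := (R : rcfType)[i].
Implicit Types (A Q : 'M[R]_n) (l : 'rV[R]_n) (x v : 'M[C]_n) (p : {mpoly C[n * n]}).

Lemma in_Cdelta_orth Q l (i j : 'I_n) : Q^T *m Q = 1%:M -> i != j -> l 0 i = l 0 j ->
  in_Cdelta (Q^T *m diag_mx l *m Q).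
Proof.
move=> QQ ij lij; split; first by rewrite !trmx_mul trmxK tr_diag_mx mulmxA.
exists (l 0 i); rewrite char_poly_orth // (bigD1 i) //= (bigD1 j) 1?eq_sym //= -lij mulrA.
by rewrite -expr2 dvdp_mulr.
Qed.

(** The square divides a product of linear factors: its first root locates [i], and after cancelling
    that factor the second one locates [j]. *)
Lemma in_CdeltaP A : in_Cdelta A -> exists Q l (i j : 'I_n),
  [/\ Q^T *m Q = 1%:M, A = Q^T *m diag_mx l *m Q, i != j & l 0 i = l 0 j].
Proof.
case=> symA [a]; have [Q [l [QQ AE]]] := real_spectral symA.
rewrite AE char_poly_orth // => dv.
have rootP (P : pred 'I_n) : 'X - a%:P %| \prod_(k | P k) ('X - (l 0 k)%:P) ->
    exists2 k, P k & l 0 k = a.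
  rewrite dvdp_XsubCl /root horner_prod => /eqP/eqP; rewrite prodf_seq_eq0.
  case/hasP => k _ /andP[Pk]; rewrite hornerXsubC subr_eq0 => /eqP ak.
  by exists k.
have [i _ li] := rootP predT (dvdp_trans (dvdp_exp2l _ (leqnSn 1)) dv).
move: dv; rewrite (bigD1 i) //= li expr2 dvdp_mul2l ?polyXsubC_eq0 // => /rootP[j ji lj].
by exists Q, l, i, j; rewrite eq_sym li lj.
Qed.

(** A real symmetric matrix is diagonalizable, so the corank of [A - a%:M] is the number of
    eigenvalues equal to [a]. *)
Lemma in_Cdelta_rank A (a : R) : A^T = A -> (\rank (A - a%:M)%R + 2 <= n)%N -> in_Cdelta A.
Proof.
move=> symA rkA; have [Q [l [QQ AE]]] := real_spectral symA.
have rQ : row_free Q by rewrite row_free_unit; have [] := mulmx1_unit QQ.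
pose d := \row_k (l 0 k - a).
have dE : A - a%:M = Q^T *m diag_mx d *m Q.
  have -> : diag_mx d = diag_mx l - a%:M.
    by apply/matrixP => i j; rewrite !mxE -mulrnBl.
  by rewrite mulmxBr mulmxBl AE mul_mx_scalar -scalemxAl QQ scalemx1.
move: rkA; rewrite dE mxrankMfree // -mxrank_tr trmx_mul trmxK mxrankMfree //.
rewrite tr_diag_mx => rkd.
have [/existsP[i /existsP[j /and3P[ij /eqP li /eqP lj]]]|nex] :=
  boolP [exists i, exists j, [&& i != j, l 0 i == a & l 0 j == a]].
  by rewrite AE; apply: (@in_Cdelta_orth _ _ i j) => //; rewrite li lj.
pose Z := [pred k | l 0 k == a].
have nz_unit (b : 'rV[R]_n) : (forall k, b 0 k != 0) -> \rank (diag_mx b) = n.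
  move=> nzb; apply: mxrank_unit; rewrite unitmxE det_diag unitfE.
  by apply/prodf_neq0 => k _; exact: nzb.
suff : (n <= \rank (diag_mx d) + 1)%N by move=> le; move: (leq_trans rkd le); rewrite leq_add2l.
have [i li|noZ] := pickP Z; last first.
  by rewrite nz_unit ?leq_addr // => k; rewrite mxE subr_eq0; have /negbT := noZ k.
(* If [i] is the only zero of [d], a rank one correction makes the matrix invertible, so its rank
   was at least n - 1. *)
have rk1 : \rank (diag_mx d + delta_mx i i)%R = n.
  have -> : diag_mx d + delta_mx i i = diag_mx (d + delta_mx 0 i).
    apply/matrixP => k k'; rewrite !mxE eqxx /=; have [<-|nkk] := eqVneq k k'.
      by rewrite andbb mulr1n.
    rewrite !mulr0n add0r; case: (eqVneq k i) => //= ki; case: (eqVneq k' i) => // ki'.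
    by rewrite ki ki' eqxx in nkk.
  apply: nz_unit => k; rewrite !mxE eqxx /=; have [->|ki] := eqVneq k i.
    by have /eqP -> := li; rewrite subrr add0r oner_eq0.
  rewrite addr0 subr_eq0; apply: contra nex => lk.
  by apply/existsP; exists k; apply/existsP; exists i; rewrite ki lk.
by have := mxrank_add (diag_mx d) (delta_mx i i); rewrite rk1 mxrank_delta.
Qed.

Lemma mxC_inj : injective (@mxC R n).
Proof.
move=> A B /matrixP AB; apply/matrixP => i j; have := AB i j.
by rewrite !mxE => -[].
Qed.

Lemma map_meval_const (k : nat) (w : 'I_k -> C) x :
  map_mx (meval w) (map_mx (@mpolyC k C) x) = x.
Proof. by apply/matrixP => i j; rewrite [LHS]mxE [X in X.@[_]]mxE mevalC. Qed.

Lemma map_mmap_const (k : nat) (B : comNzRingType) (f : {rmorphism C -> B}) (h : 'I_k -> B) x :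
  map_mx (mmap f h) (map_mx (@mpolyC k C) x) = map_mx f x.
Proof. by apply/matrixP => i j; rewrite [LHS]mxE [X in mmap _ _ X]mxE [RHS]mxE mmapC. Qed.

Lemma meval_mmap (k : nat) (X : 'M[{mpoly C[k]}]_n) (w : 'I_k -> C) p :
  (mmap (@mpolyC k C) (coords X) p).@[w] = p.@[coords (map_mx (meval w) X)].
Proof.
rewrite (rmorph_mmap (meval w)); apply: eq_mmap => [c|i] /=; first exact: mevalC.
exact: map_coords.
Qed.

Lemma horner_mmap (X : 'M[{poly C}]_n) (t : C) p :
  (mmap polyC (coords X) p).[t] = p.@[coords (map_mx (horner_eval t) X)].
Proof.
rewrite -/(horner_eval t _) rmorph_mmap; apply: eq_mmap => [c|i] /=.
  exact: hornerC.
exact: map_coords.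
Qed.

Lemma deriv_curve (X : 'M[{poly C}]_n) p :
  (mmap polyC (coords X) p)^`().[0] =
  \sum_(k < n * n) (p^`M(k)).@[coords (map_mx (horner_eval 0) X)] *
    coords (map_mx (horner_eval 0 \o deriv) X) k.
Proof.
rewrite deriv_mmap -[LHS]/(horner_eval 0 _) rmorph_sum; apply: eq_bigr => k _.
rewrite rmorphM /= {1}/horner_eval horner_mmap; congr (_ * _).
exact: (map_coords (horner_eval 0 \o deriv)).
Qed.

(** A polynomial vanishing on the variety, restricted to the curve, has all natural numbers as
    roots; it is therefore zero, and so is its derivative at 0. *)
Lemma tangent_curve (X : 'M[{poly C}]_n) :
  (forall k : nat, in_XC (map_mx (horner_eval k%:R) X)) ->
  tangent_XC (map_mx (horner_eval 0) X) (map_mx (horner_eval 0 \o deriv) X).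
Proof.
move=> inX p vp; rewrite -deriv_curve.
suff -> : mmap polyC (coords X) p = 0 by rewrite deriv0 horner0.
apply: poly_nat_roots => [a b /eqP|k]; first by rewrite eqr_nat => /eqP.
by rewrite horner_mmap; apply: inX.
Qed.

Definition polycurve (d : nat) (W : nat -> 'M[C]_n) : 'M[{poly C}]_n :=
  \matrix_(a, b) \poly_(i < d) W i a b.

Lemma horner_polycurve d W (t : C) :
  map_mx (horner_eval t) (polycurve d W) = \sum_(i < d) t ^+ i *: W i.
Proof.
apply/matrixP => a b; rewrite !mxE /horner_eval horner_poly summxE.
by apply: eq_bigr => i _; rewrite mxE mulrC.
Qed.

(** The length [d.+2] ensures that both the base point [W 0] and the velocity [W 1] are among the
    coefficients. *)
Lemma tangent_polycurve (d : nat) (W : nat -> 'M[C]_n) :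
  (forall k : nat, in_XC (\sum_(i < d.+2) k%:R ^+ i *: W i)) -> tangent_XC (W 0%N) (W 1%N).
Proof.
move=> inX; have := @tangent_curve (polycurve d.+2 W).
rewrite (_ : map_mx (horner_eval 0) _ = W 0%N); last first.
  rewrite horner_polycurve big_ord_recl /= expr0 scale1r big1 ?addr0 // => i _.
  by rewrite expr0n scale0r.
rewrite (_ : map_mx _ _ = W 1%N); last first.
  apply/matrixP => a b; rewrite !mxE /= /horner_eval horner_coef0 coef_deriv coef_poly /=.
  by rewrite mulr1n.
by apply=> k; rewrite horner_polycurve.
Qed.

(** * Congruences preserving the variety *)

Section Conjugation.
Variable G : 'M[R]_n.
Hypothesis Gdelta : forall A, in_Cdelta A -> in_Cdelta (G *m A *m G^T).
Let Gc : 'M[C]_n := mxC G.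

(** The pullback of [p] along Y -> G Y G^T, obtained by substituting the entries of the transformed
    generic matrix. *)
Definition conj_mpoly p : {mpoly C[n * n]} :=
  mmap (@mpolyC (n * n) C)
    (coords (map_mx (@mpolyC _ C) Gc *m generic_mx C n *m (map_mx (@mpolyC _ C) Gc)^T)) p.

Lemma conj_mpoly_eval p x : (conj_mpoly p).@[coords x] = p.@[coords (Gc *m x *m Gc^T)].
Proof.
by rewrite meval_mmap !map_mxM map_generic_mx map_trmx !map_meval_const.
Qed.

Lemma conj_mpoly_vanishes p : vanishes_on_Cdelta p -> vanishes_on_Cdelta (conj_mpoly p).
Proof.
move=> vp A dA; rewrite conj_mpoly_eval [Gc^T]map_trmx -!map_mxM.
exact/vp/Gdelta.
Qed.

Lemma in_XC_conj x : in_XC x -> in_XC (Gc *m x *m Gc^T).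
Proof. by move=> inx p vp; rewrite -conj_mpoly_eval; apply/inx/conj_mpoly_vanishes. Qed.

(** Reading the differential of [p] as a derivative along the line x + t v lets polynomial
    substitutions act directly on tangency conditions. *)
Lemma tangent_line x v p :
  \sum_(k < n * n) (p^`M(k)).@[coords x] * coords v k =
  (mmap polyC (coords (map_mx polyC x + 'X *: map_mx polyC v)) p)^`().[0].
Proof.
rewrite deriv_curve; apply: eq_bigr => k _; congr (_ .@[coords _] * coords _ k).
  by apply/matrixP => i j; rewrite !mxE /horner_eval !hornerE.
by apply/matrixP => i j; rewrite !mxE /= /horner_eval !derivE !hornerE.
Qed.

Lemma tangent_conj x v : tangent_XC x v -> tangent_XC (Gc *m x *m Gc^T) (Gc *m v *m Gc^T).
Proof.
move=> tv p vp; rewrite -[RHS](tv _ (conj_mpoly_vanishes vp)) !tangent_line.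
congr (_^`().[0]); rewrite /conj_mpoly; set Y := _ + 'X *: map_mx polyC v.
rewrite (rmorph_mmap (mmap polyC (coords Y))); apply: eq_mmap => [c|k] /=.
  by rewrite mmapC.
rewrite [RHS](map_coords (mmap polyC (coords Y))) !map_mxM mmap_generic_mx map_trmx.
rewrite !map_mmap_const /Y.
by rewrite mulmxDr mulmxDl -scalemxAr -scalemxAl.
Qed.
End Conjugation.
End Closure.

(** * Tangent vectors *)

Section Tangent.
Variables (R : realType) (n : nat).
Local Notation C := (R : rcfType)[i].
Implicit Types (A Q : 'M[R]_n) (l : 'rV[R]_n) (x v : 'M[C]_n) (p : {mpoly C[n * n]}).

Lemma mxCM Q A : mxC (Q *m A) = mxC Q *m mxC A.
Proof. exact: map_mxM. Qed.

Lemma mxCT A : mxC A^T = (mxC A)^T.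
Proof. by rewrite /mxC map_trmx. Qed.

Lemma mxC1 : mxC (1%:M : 'M[R]_n) = 1%:M.
Proof. exact: map_mx1. Qed.

Lemma mxC_diag l : mxC (diag_mx l) = diag_mx (map_mx (real_complex R) l).
Proof. exact: map_diag_mx. Qed.

(** The factor [c] admits curves of multiples of rotations with entries polynomial in the parameter;
    normalizing them would introduce denominators. *)
Lemma in_Cdelta_conj Q (c : R) A : Q *m Q^T = 1%:M -> in_Cdelta A ->
  in_Cdelta ((c *: Q) *m A *m (c *: Q)^T).
Proof.
move=> QQ /in_CdeltaP[P [l [i [j [PP -> ij lij]]]]].
have -> : (c *: Q) *m (P^T *m diag_mx l *m P) *m (c *: Q)^T =
    (P *m Q^T)^T *m diag_mx (c ^+ 2 *: l) *m (P *m Q^T).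
  rewrite trmx_mul trmxK linearZ /= -!scalemxAl -!scalemxAr scalerA -expr2 linearZ /=.
  by rewrite -!scalemxAr -scalemxAl !mulmxA.
apply: (@in_Cdelta_orth _ _ _ _ i j) => //; last by rewrite !mxE lij.
by rewrite trmx_mul trmxK mulmxA -(mulmxA Q) PP mulmx1.
Qed.

Lemma in_Cdelta_orthconj Q A : Q *m Q^T = 1%:M -> in_Cdelta A -> in_Cdelta (Q *m A *m Q^T).
Proof. by move=> QQ dA; have := in_Cdelta_conj 1 QQ dA; rewrite scale1r. Qed.

(** Conjugation by [Q] is a linear isomorphism of tangent spaces, with inverse the conjugation by
    [Q^T]. *)
Lemma subspace_dim_conj Q x d : Q *m Q^T = 1%:M -> subspace_dim (tangent_XC x) d ->
  subspace_dim (tangent_XC (mxC Q *m x *m (mxC Q)^T)) d.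
Proof.
move=> QQ [[B [TB freeB]] maxd].
have QtQ : Q^T *m Q = 1%:M by apply: mulmx1C.
have QtQc : (mxC Q)^T *m mxC Q = 1%:M by rewrite -mxCT -mxCM QtQ mxC1.
have QQc : mxC Q *m (mxC Q)^T = 1%:M by rewrite -mxCT -mxCM QQ mxC1.
have cancel_conj y : (mxC Q)^T *m (mxC Q *m y *m (mxC Q)^T) *m mxC Q = y.
  by rewrite !mulmxA QtQc mul1mx -mulmxA QtQc mulmx1.
have conj_cancel y : mxC Q *m ((mxC Q)^T *m y *m mxC Q) *m (mxC Q)^T = y.
  by rewrite !mulmxA QQc mul1mx -mulmxA QQc mulmx1.
split.
  exists (fun i => mxC Q *m B i *m (mxC Q)^T); split=> [i|c e i].
    by apply: tangent_conj => // A; apply: in_Cdelta_orthconj.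
  apply: freeB; rewrite -[LHS]cancel_conj mulmx_sumr mulmx_suml.
  rewrite (_ : \sum_i0 _ = 0) ?mulmx0 ?mul0mx // -[RHS]e; apply: eq_bigr => k _.
  by rewrite -scalemxAr -scalemxAl.
move=> d' B' TB' freeB'; apply: (maxd d' (fun i => (mxC Q)^T *m B' i *m mxC Q)).
  move=> i; have := @tangent_conj _ _ Q^T _ _ _ (TB' i); rewrite mxCT !trmxK cancel_conj.
  by apply=> A dA; rewrite -{2}[Q]trmxK; apply: in_Cdelta_orthconj; rewrite ?trmxK.
move=> c e i; apply: freeB'; rewrite -[LHS]conj_cancel mulmx_sumr mulmx_suml.
rewrite (_ : \sum_i0 _ = 0) ?mulmx0 ?mul0mx // -[RHS]e; apply: eq_bigr => k _.
by rewrite -scalemxAr -scalemxAl.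
Qed.

(** Orthogonal conjugation preserves the variety, its tangent spaces and the trace form; this
    reduces the problem to diagonal [A]. *)
Lemma ED_critical_conj Q A x : Q *m Q^T = 1%:M -> ED_critical A x ->
  ED_critical (Q *m A *m Q^T) (mxC Q *m x *m (mxC Q)^T).
Proof.
move=> QQ [[inx [d [dimd Td]]] orthA].
have QtQ : Q^T *m Q = 1%:M by apply: mulmx1C.
have QtQc : (mxC Q)^T *m mxC Q = 1%:M by rewrite -mxCT -mxCM QtQ mxC1.
split; first split.
- by apply: in_XC_conj => // B; apply: in_Cdelta_orthconj.
- by exists d; split=> //; apply: subspace_dim_conj.
move=> v Tv; rewrite !mxCM mxCT -mulmxBl -mulmxBr !trmx_mul trmxK.
rewrite -mulmxA mxtrace_mulC -!mulmxA (mulmxA (mxC Q)^T).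
apply: orthA; have := @tangent_conj _ _ Q^T _ _ _ Tv; rewrite mxCT !trmxK.
rewrite (_ : (mxC Q)^T *m (_ *m x *m _) *m mxC Q = x) => [|].
  by apply=> B dB; rewrite -{2}[Q]trmxK; apply: in_Cdelta_orthconj; rewrite ?trmxK.
by rewrite !mulmxA QtQc mul1mx -mulmxA QtQc mulmx1.
Qed.

(** For natural entries the matrix is real and lies in [in_Cdelta]; a polynomial zero at all these
    points is zero on the whole linear space of such diagonal matrices. *)
Lemma in_XC_diag (mu : 'rV[C]_n) (i j : 'I_n) : i != j -> mu 0 i = mu 0 j ->
  in_XC (diag_mx mu).
Proof.
move=> ij mij p vp.
(* Substituting variable [i] for variable [j] parametrizes the diagonals with equal entries
   there. *)
pose s k := if k == j then i else k.
pose X : 'M[{mpoly C[n]}]_n := diag_mx (\row_k 'X_(s k)).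
have evX w : map_mx (meval w) X = diag_mx (\row_k w (s k)).
  rewrite map_diag_mx; congr diag_mx; apply/rowP => k.
  by rewrite !mxE /= mevalXU.
have q0 : mmap (@mpolyC n C) (coords X) p = 0.
  apply: mpoly_nat_eq0 => w; rewrite meval_mmap evX.
  have -> : diag_mx (\row_k (w (s k))%:R) = mxC (diag_mx (\row_k (w (s k))%:R)) :> 'M[C]_n.
    by rewrite mxC_diag; congr diag_mx; apply/rowP => k; rewrite !mxE rmorph_nat.
  apply: vp; rewrite -[diag_mx _]mulmx1 -[diag_mx _]mul1mx -{1}trmx1.
  apply: (@in_Cdelta_orth _ _ _ _ i j) => //; first by rewrite trmx1 mulmx1.
  by rewrite !mxE /s eqxx (negbTE ij).
have := meval_mmap X (fun k => mu 0 k) p; rewrite q0 meval0 evX.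
rewrite (_ : \row_k _ = mu) => [<- //|].
by apply/rowP => k; rewrite mxE /s; case: eqP => [->|].
Qed.

Definition sym_mpoly (a b : 'I_n) : {mpoly C[n * n]} :=
  'X_(mxvec_index a b) - 'X_(mxvec_index b a).

Lemma sym_mpoly_vanishes a b : vanishes_on_Cdelta (sym_mpoly a b).
Proof.
move=> A [symA _]; rewrite mevalB !mevalXU /coords !mxvecE.
by rewrite -[in X in _ - X]symA !mxE subrr.
Qed.

Lemma in_XC_sym x : in_XC x -> x^T = x.
Proof.
move=> inx; apply/matrixP => a b; rewrite mxE.
have := inx _ (sym_mpoly_vanishes b a); rewrite mevalB !mevalXU /coords !mxvecE.
by move/eqP; rewrite subr_eq0 => /eqP.
Qed.

Lemma tangent_sym x v : tangent_XC x v -> v^T = v.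
Proof.
move=> Tv; apply/matrixP => a b; rewrite mxE.
have := Tv _ (sym_mpoly_vanishes b a); rewrite tangent_line raddfB /= !mmapX !mmap1U.
rewrite /coords !mxvecE !mxE !derivE !hornerE => /eqP; rewrite subr_eq0.
by move/eqP.
Qed.

Lemma tangentZ x (c : C) v : tangent_XC x v -> tangent_XC x (c *: v).
Proof.
move=> Tv p vp; transitivity (c * 0); last exact: mulr0.
rewrite -[X in c * X](Tv p vp) mulr_sumr; apply: eq_bigr => k _.
by rewrite /coords linearZ mxE mulrCA.
Qed.

Lemma tangent_diag (mu d : 'rV[C]_n) (i j : 'I_n) : i != j ->
  mu 0 i = mu 0 j -> d 0 i = d 0 j -> tangent_XC (diag_mx mu) (diag_mx d).
Proof.
move=> ij mij dij.
pose W k := if k is 0 then diag_mx mu else diag_mx d.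
apply: (@tangent_polycurve _ _ 0 W) => k.
rewrite !big_ord_recl big_ord0 /= addr0 expr0 expr1 scale1r.
rewrite -linearZ -linearD; apply: (in_XC_diag ij).
by rewrite !mxE mij dij.
Qed.

(** The infinitesimal rotation in the coordinate plane of [a] and [b]. *)
Definition skewE (F : pzRingType) (a b : 'I_n) : 'M[F]_n := delta_mx a b - delta_mx b a.

(* For a skew matrix with E^3 = -E, the Cayley-type curve (1 + t^2) + 2 t E + 2 t^2 E^2
   is (1 + t^2) times a rotation. *)
Lemma skew_rotation (F : fieldType) (E : 'M[F]_n) (t : F) :
  E^T = - E -> E *m (E *m E) = - E ->
  let G := 1%:M + (2 * t) *: E + t ^+ 2 *: (1%:M + 2 *: (E *m E)) in
  G *m G^T = ((1 + t ^+ 2) ^+ 2)%:M.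
Proof.
move=> skE cubE G.
have E2T : (E *m E)^T = E *m E by rewrite trmx_mul skE mulmxN mulNmx opprK.
have [E2 E2E] : exists E2, E2 = E *m E by eexists.
have EE2 : E *m E2 = - E by rewrite E2E.
have E2E1 : E2 *m E = - E by rewrite E2E -mulmxA.
have E22 : E2 *m E2 = - E2 by rewrite {1}E2E -mulmxA EE2 mulmxN -E2E.
pose al := 1 + t ^+ 2.
have GE : G = al%:M + (2 * t) *: E + (2 * t ^+ 2) *: E2.
  rewrite /G -E2E scalerDr scalerA [t ^+ 2 * 2]mulrC /al raddfD /= -[(t ^+ 2)%:M]scalemx1.
  by rewrite !addrA; congr (_ + _); rewrite addrAC.
have GT : G^T = al%:M - (2 * t) *: E + (2 * t ^+ 2) *: E2.
  rewrite GE !linearD /= !linearZ /= tr_scalar_mx skE {1}E2E E2T -E2E scalerN.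
  by [].
rewrite GT GE !mulmxDl !mulmxDr !mulmxN -!scalemxAl -!scalemxAr EE2 E2E1 E22.
rewrite -E2E !mul_scalar_mx !mul_mx_scalar.
apply/matrixP => i j; rewrite !mxE /al.
by case: (i == j); rewrite ?mulr1n ?mulr0n; ring.
Qed.

Lemma skewE_cube (F : pzRingType) (a b : 'I_n) : a != b ->
  skewE F a b *m (skewE F a b *m skewE F a b) = - skewE F a b.
Proof.
move=> ab; have ba : b != a by rewrite eq_sym.
have -> : skewE F a b *m skewE F a b = - (delta_mx a a + delta_mx b b).
  rewrite /skewE mulmxBl !mulmxBr !mul_delta_mx_cond !eqxx (negbTE ab) (negbTE ba).
  by rewrite !mulr1n !mulr0n sub0r subr0 opprD.
rewrite /skewE mulmxN mulmxDr !mulmxBl !mul_delta_mx_cond !eqxx (negbTE ab) (negbTE ba).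
by rewrite !mulr1n !mulr0n sub0r subr0 addrC.
Qed.

Lemma skewE_tr (F : pzRingType) (a b : 'I_n) : (skewE F a b)^T = - skewE F a b.
Proof. by rewrite /skewE linearB /= !trmx_delta opprB. Qed.

Lemma mxC_skewE a b : mxC (skewE R a b) = skewE C a b.
Proof. by rewrite /mxC /skewE map_mxB !map_delta_mx. Qed.

(** The expansion of G x G^T in powers of [s]. Skewness of [E] turns the linear coefficient into
    twice a commutator. *)
Lemma conj_expansion (F : comNzRingType) (E K x : 'M[F]_n) (s : F) :
  E^T = - E -> K^T = K ->
  let G := 1%:M + (2 * s) *: E + s ^+ 2 *: K in
  \sum_(i < 5) s ^+ i *: nth 0 [:: x; 2 *: (E *m x - x *m E);
    K *m x + x *m K - 4 *: (E *m x *m E); 2 *: (E *m x *m K - K *m x *m E); K *m x *m K] i =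
  G *m x *m G^T.
Proof.
move=> ET KT G.
have -> : G^T = 1%:M - (2 * s) *: E + s ^+ 2 *: K.
  by rewrite !linearD !linearZ /= trmx1 ET KT scalerN.
rewrite /G !big_ord_recl big_ord0 /= addr0 /bump /= !addn0.
rewrite !mulmxDl !mulmxDr !mul1mx !mulmx1 !mulmxN -!scalemxAl -!scalemxAr.
move: (E *m x *m E) (E *m x *m K) (K *m x *m E) (K *m x *m K) => M1 M2 M3 M4.
move: (E *m x) (x *m E) (K *m x) (x *m K) => N1 N2 N3 N4.
by apply/matrixP => i j; rewrite !mxE; ring.
Qed.

Lemma tangent_skew x (a b : 'I_n) : a != b -> in_XC x ->
  tangent_XC x (skewE C a b *m x - x *m skewE C a b).
Proof.
move=> ab inx; set E := skewE C a b.
pose K := 1%:M + 2 *: (E *m E).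
have KT : K^T = K.
  by rewrite /K linearD linearZ /= trmx1 trmx_mul skewE_tr mulmxN mulNmx opprK.
pose W := nth 0 [:: x; 2 *: (E *m x - x *m E);
  K *m x + x *m K - 4 *: (E *m x *m E); 2 *: (E *m x *m K - K *m x *m E); K *m x *m K].
have two : (2 : C) != 0 by rewrite pnatr_eq0.
rewrite -[_ - _]scale1r -(mulVf two) -scalerA; apply: tangentZ.
(* The curve G is quadratic in the parameter, so G x G^T has degree 4 and [3.+2] coefficients. *)
apply: (@tangent_polycurve _ _ 3 W) => k.
pose t : R := k%:R.
have [Er ErE] : exists Er, Er = skewE R a b by eexists.
pose G := 1%:M + (2 * t) *: Er + t ^+ 2 *: (1%:M + 2 *: (Er *m Er)).
have nz : 1 + t ^+ 2 != 0 by rewrite gt_eqF // ltr_pwDl ?ltr01 ?sqr_ge0.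
have GG : G *m G^T = ((1 + t ^+ 2) ^+ 2)%:M.
  by apply: skew_rotation; rewrite ErE; [exact: skewE_tr|exact: skewE_cube].
pose Q := (1 + t ^+ 2)^-1 *: G.
have QQ : Q *m Q^T = 1%:M.
  rewrite linearZ /= -scalemxAl -scalemxAr scalerA GG -scalemx1 scalerA -expr2 -exprMn.
  by rewrite mulVf // expr1n scale1r.
have GQ : G = (1 + t ^+ 2) *: Q by rewrite scalerA divff // scale1r.
have GC : mxC G = 1%:M + (2 * k%:R) *: E + k%:R ^+ 2 *: K.
  rewrite /mxC /G !(map_mxD, map_mxZ, map_mxM, map_mx1).
  have -> : map_mx (real_complex R) Er = E by rewrite ErE; exact: mxC_skewE.
  rewrite rmorphXn rmorphM /= !rmorph_nat.
  by [].
suff -> : \sum_(i < 5) k%:R ^+ i *: W i = mxC G *m x *m (mxC G)^T.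
  apply: in_XC_conj => // A dA; rewrite GQ; exact: in_Cdelta_conj.
by rewrite GC; apply: conj_expansion KT; exact: skewE_tr.
Qed.
End Tangent.

(** * Determinantal equations *)

Section RootProduct.
Variables (F : comNzRingType) (n : nat).

(** The value at [Y] of the monic polynomial with roots [s], written as a fold through which ring
    morphisms pass easily. *)
Definition root_prod_mx (s : seq F) (Y : 'M[F]_n) : 'M[F]_n :=
  foldr (fun a Z => (Y - a%:M) *m Z) 1%:M s.

Lemma root_prod_mx_orth (s : seq F) (P : 'M[F]_n) (l : 'rV[F]_n) :
  P^T *m P = 1%:M -> P *m P^T = 1%:M ->
  root_prod_mx s (P^T *m diag_mx l *m P) =
  P^T *m diag_mx (\row_k \prod_(a <- s) (l 0 k - a)) *m P.
Proof.
move=> PtP PPt; elim: s => [|a s IH] /=.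
  rewrite (_ : \row__ _ = const_mx 1); last by apply/rowP => k; rewrite !mxE big_nil.
  by rewrite diag_const_mx mulmx1.
rewrite IH (_ : _ - a%:M = P^T *m (diag_mx l - a%:M) *m P); last first.
  by rewrite mulmxBr mulmxBl mul_mx_scalar -scalemxAl PtP scalemx1.
rewrite -!mulmxA (mulmxA P) PPt mul1mx; congr (_ *m _); rewrite !mulmxA; congr (_ *m _).
rewrite -[a%:M]diag_const_mx -raddfB /= mulmx_diag; congr diag_mx.
by apply/rowP => k; rewrite !mxE big_cons.
Qed.

Lemma root_prod_mx_diag (s : seq F) (l : 'rV[F]_n) :
  root_prod_mx s (diag_mx l) = diag_mx (\row_k \prod_(a <- s) (l 0 k - a)).
Proof.
have := @root_prod_mx_orth s 1%:M l; rewrite trmx1 !mul1mx !mulmx1.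
by apply.
Qed.

(** Tests n polynomials in [Y] against n linear forms [\tr (K r *m _)]; over a field the determinant
    is zero once the powers of [Y] span fewer than n dimensions. *)
Definition root_minor (K : 'I_n -> 'M[F]_n) (s : 'I_n -> seq F) (Y : 'M[F]_n) : 'M[F]_n :=
  \matrix_(r, c) \tr (K r *m root_prod_mx (s c) Y).

Lemma mxtrace_mul_diag (K : 'M[F]_n) (d : 'rV[F]_n) :
  \tr (K *m diag_mx d) = \sum_k K k k * d 0 k.
Proof. by apply: eq_bigr => k _; rewrite mul_mx_diag mxE. Qed.

(** The matrix factors through the values of the polynomials at the eigenvalues, and a repeated
    eigenvalue gives that factor two equal rows. *)
Lemma det_root_minor_orth (K : 'I_n -> 'M[F]_n) (s : 'I_n -> seq F) (P : 'M[F]_n)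
    (l : 'rV[F]_n) (i j : 'I_n) :
  P^T *m P = 1%:M -> P *m P^T = 1%:M -> i != j -> l 0 i = l 0 j ->
  \det (root_minor K s (P^T *m diag_mx l *m P)) = 0.
Proof.
move=> PtP PPt ij lij.
have -> : root_minor K s (P^T *m diag_mx l *m P) =
    (\matrix_(r, k) (P *m K r *m P^T) k k) *m
    (\matrix_(k, c) \prod_(a <- s c) (l 0 k - a)).
  apply/matrixP => r c; rewrite [LHS]mxE [RHS]mxE root_prod_mx_orth // mulmxA mxtrace_mulC.
  rewrite !mulmxA mxtrace_mul_diag; apply: eq_bigr => k _.
  by rewrite ![(\row__ _) _ _]mxE ![(\matrix_(_, _) _) _ _]mxE.
rewrite det_mulmx [X in _ * X](determinant_alternate ij) ?mulr0 // => c.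
by rewrite !mxE lij.
Qed.
End RootProduct.

Lemma map_root_prod_mx (F B : comNzRingType) (f : {rmorphism F -> B}) (n : nat)
    (s : seq F) (Y : 'M[F]_n) :
  map_mx f (root_prod_mx s Y) = root_prod_mx (map f s) (map_mx f Y).
Proof.
elim: s => [|a s IH] /=; first exact: map_mx1.
by rewrite map_mxM IH map_mxB map_scalar_mx.
Qed.

Lemma map_root_minor (F B : comNzRingType) (f : {rmorphism F -> B}) (n : nat)
    (K : 'I_n -> 'M[F]_n) (s : 'I_n -> seq F) (Y : 'M[F]_n) :
  map_mx f (root_minor K s Y) =
  root_minor (fun r => map_mx f (K r)) (fun c => map f (s c)) (map_mx f Y).
Proof.
apply/matrixP => r c; rewrite [LHS]mxE [X in f X]mxE [RHS]mxE -trace_map_mx map_mxM.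
by rewrite map_root_prod_mx.
Qed.

Lemma deriv_prod_double_zero (F : comNzRingType) (I : finType) (m : I -> {poly F}) (a b : I) :
  a != b -> (m a).[0] = 0 -> (m b).[0] = 0 -> (\prod_r m r)^`().[0] = 0.
Proof.
move=> ab ma mb; rewrite (bigD1 a) //= (bigD1 b) 1?eq_sym //=.
by rewrite !derivM !(hornerD, hornerM) ma mb !(mul0r, mulr0, addr0).
Qed.

(** In the Leibniz formula only the identity contributes to first order: any other permutation picks
    at least two off-diagonal entries, which vanish at 0. *)
Lemma deriv_det_diag (F : comNzRingType) (n : nat) (M : 'M[{poly F}]_n) (j : 'I_n) :
  (forall r c, r != c -> (M r c).[0] = 0) -> (M j j).[0] = 0 ->
  (\det M)^`().[0] = (M j j)^`().[0] * \prod_(r | r != j) (M r r).[0].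
Proof.
move=> offM Mj; rewrite /determinant raddf_sum /= -/(horner_eval 0 _) raddf_sum /=.
rewrite (bigD1 (1%g : {perm 'I_n})) //= [X in _ + X]big1 ?addr0 => [|s s1].
  rewrite odd_perm1 expr0 mul1r.
  rewrite (eq_bigr (fun r => M r r)) => [|r _]; last by rewrite perm1.
  rewrite (bigD1 j) //= /horner_eval derivM hornerD !hornerM.
  by rewrite Mj mul0r addr0 horner_prod.
have [a sa] : exists a, s a != a.
  apply/existsP; apply: contraNT s1; rewrite negb_exists => /forallP sid.
  by apply/eqP/permP => a; rewrite perm1; apply/eqP; rewrite -[_ == _]negbK.
rewrite -signr_odd -[(-1) ^+ _](rmorph_sign polyC) mul_polyC derivZ /horner_eval hornerZ.
rewrite (@deriv_prod_double_zero _ _ _ a (s a)) ?mulr0 //; first by rewrite eq_sym.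
  by apply: offM; rewrite eq_sym.
by apply: offM; rewrite eq_sym (inj_eq perm_inj).
Qed.

Lemma map_horner_const (F : comNzRingType) (n : nat) (t : F) (x : 'M[F]_n) :
  map_mx (horner_eval t) (map_mx polyC x) = x.
Proof.
by apply/matrixP => a b; rewrite [LHS]mxE [X in horner_eval _ X]mxE; exact: hornerC.
Qed.

(** * Equations of the closure and of its tangent spaces *)

Section Minors.
Variables (R : realType) (n : nat).
Local Notation C := (R : rcfType)[i].
Implicit Types (K : 'I_n -> 'M[C]_n) (s : 'I_n -> seq C) (x v : 'M[C]_n).

Definition minor_mpoly K s : {mpoly C[n * n]} :=
  \det (root_minor (fun r => map_mx (@mpolyC _ C) (K r)) (fun c => map (@mpolyC _ C) (s c))
    (generic_mx C n)).

Lemma mmap_minor (B : comNzRingType) (f : {rmorphism C -> B}) (Y : 'M[B]_n) K s :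
  mmap f (coords Y) (minor_mpoly K s) =
  \det (root_minor (fun r => map_mx f (K r)) (fun c => map f (s c)) Y).
Proof.
rewrite /minor_mpoly -det_map_mx map_root_minor mmap_generic_mx; congr (\det _).
apply/matrixP => r c; rewrite [LHS]mxE [RHS]mxE map_mmap_const -map_comp.
by congr (\tr (_ *m root_prod_mx _ _)); apply: eq_map => a; apply: mmapC.
Qed.

Lemma meval_minor x K s : (minor_mpoly K s).@[coords x] = \det (root_minor K s x).
Proof.
rewrite [LHS]mmap_minor; congr (\det _); apply/matrixP => r c; rewrite [LHS]mxE [RHS]mxE.
by rewrite map_mx_id // map_id.
Qed.

Lemma minor_vanishes K s : vanishes_on_Cdelta (minor_mpoly K s).
Proof.
move=> A /in_CdeltaP[Q [l [i [j [QQ -> ij lij]]]]]; rewrite meval_minor !mxCM mxCT mxC_diag.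
apply: (@det_root_minor_orth _ _ _ _ _ _ i j) => //; last by rewrite !mxE lij.
  by rewrite -mxCT -mxCM QQ mxC1.
by rewrite -mxCT -mxCM (mulmx1C QQ) mxC1.
Qed.

(** If the entries were distinct, taking for [s c] all of them but the [c]-th gives the Lagrange
    numerators; the tested matrix is then diagonal with nonzero entries, against the vanishing of
    its determinant. *)
Lemma in_XC_diag_eq (mu : 'rV[C]_n) : in_XC (diag_mx mu) ->
  exists i j : 'I_n, i != j /\ mu 0 i = mu 0 j.
Proof.
move=> inx.
have [/existsP[i /existsP[j /andP[ij /eqP mij]]]|nex] :=
  boolP [exists i, exists j, (i != j) && (mu 0 i == mu 0 j)]; first by exists i, j.
have mu_inj k k' : mu 0 k = mu 0 k' -> k = k'.
  move=> e; apply/eqP; apply: contraNT nex => kk'.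
  by apply/existsP; exists k; apply/existsP; exists k'; rewrite kk' e eqxx.
pose s (c : 'I_n) := [seq mu 0 k | k <- enum 'I_n & k != c].
have := inx _ (minor_vanishes (fun r => delta_mx r r) s); rewrite meval_minor.
have -> : root_minor (fun r => delta_mx r r) s (diag_mx mu) =
    diag_mx (\row_r \prod_(a <- s r) (mu 0 r - a)).
  apply/matrixP => r c; rewrite [LHS]mxE root_prod_mx_diag mxtrace_mul_diag (bigD1 r) //=.
  rewrite big1 => [|k kr]; last by rewrite [delta_mx _ _ _ _]mxE (negbTE kr) mul0r.
  rewrite !mxE !eqxx /= mul1r addr0; have [->|rc] := eqVneq r c; first by rewrite mulr1n.
  rewrite mulr0n; apply/eqP; rewrite prodf_seq_eq0; apply/hasP; exists (mu 0 r).
    by apply/mapP; exists r; rewrite // mem_filter rc mem_enum.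
  by rewrite /= subrr.
rewrite det_diag => /eqP; rewrite prodf_seq_eq0 => /hasP[r _]; rewrite /= mxE.
rewrite prodf_seq_eq0 => /hasP[a /mapP[k]]; rewrite mem_filter => /andP[kr _] -> /=.
by rewrite subr_eq0 => /eqP /mu_inj rk; rewrite rk eqxx in kr.
Qed.

(** A minor is chosen whose matrix at [diag_mx mu] is diagonal with its only zero at [j]. Its
    derivative along [v] is then a nonzero multiple of [\tr (N *m v)]. *)
Lemma tangent_double_eigen (mu : 'rV[C]_n) (i j : 'I_n) (N v : 'M[C]_n) :
  i != j -> mu 0 i = mu 0 j ->
  (forall k k', k != k' -> k != j -> k' != j -> mu 0 k != mu 0 k') ->
  (forall a b, N a b != 0 -> (a \in [:: i; j]) && (b \in [:: i; j])) -> \tr N = 0 ->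
  tangent_XC (diag_mx mu) v -> \tr (N *m v) = 0.
Proof.
move=> ij mij mu_inj supN trN Tv.
pose s0 (c : 'I_n) := [seq mu 0 k | k <- enum 'I_n & (k != c) && (k != j)].
(* For [c = j] this is the minimal polynomial of [diag_mx mu]; the other columns use the Lagrange
   numerators of the distinct eigenvalues. *)
pose s (c : 'I_n) := if c == j then mu 0 i :: s0 i else s0 c.
pose K (r : 'I_n) := if r == j then N else delta_mx r r.
pose g c r := \prod_(a <- s c) (mu 0 r - a).
have memij a : a \in [:: i; j] -> mu 0 a = mu 0 i.
  by rewrite !inE => /orP[] /eqP ->.
have trNd (d : 'rV[C]_n) : d 0 i = d 0 j -> \tr (N *m diag_mx d) = 0.
  move=> dij; rewrite mxtrace_mul_diag -[RHS](mul0r (d 0 i)) -[in RHS]trN mulr_suml.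
  apply: eq_bigr => k _; have [->|/supN/andP[]] := eqVneq (N k k) 0; first by rewrite !mul0r.
  by rewrite !inE => /orP[] /eqP -> // _; rewrite dij.
have M0 : root_minor K s (diag_mx mu) = diag_mx (\row_r if r == j then 0 else g r r).
  apply/matrixP => r c; rewrite [LHS]mxE root_prod_mx_diag /K; case: (eqVneq r j) => [->|rj].
    by rewrite trNd ?mxE ?mij // eqxx mul0rn.
  rewrite mxtrace_mul_diag (bigD1 r) //= big1 => [|k kr]; last first.
    by rewrite [delta_mx _ _ _ _]mxE (negbTE kr) mul0r.
  rewrite !mxE !eqxx /= mul1r addr0 (negbTE rj) -/(g c r).
  have [->|rc] := eqVneq r c; first by rewrite mulr1n.
  rewrite mulr0n; apply/eqP; rewrite prodf_seq_eq0; apply/hasP; exists (mu 0 r); last first.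
    by rewrite /= subrr.
  rewrite /s; case: (eqVneq c j) => [_|cj]; last first.
    by apply/mapP; exists r; rewrite // mem_filter rc rj mem_enum.
  rewrite inE; have [->|ri] := eqVneq r i; first by rewrite eqxx.
  by apply/orP; right; apply/mapP; exists r; rewrite // mem_filter ri rj mem_enum.
have gnz r : r != j -> g r r != 0.
  move=> rj; rewrite prodf_seq_neq0; apply/allP => a; rewrite /s (negbTE rj).
  case/mapP => k; rewrite mem_filter => /andP[/andP[kr kj] _] -> /=.
  by rewrite subr_eq0 mu_inj // eq_sym.
pose Y := map_mx polyC (diag_mx mu) + 'X *: map_mx polyC v.
pose M := root_minor (fun r => map_mx polyC (K r)) (fun c => map polyC (s c)) Y.
have Yev : map_mx (horner_eval 0) Y = diag_mx mu.
  by apply/matrixP => a b; rewrite mxE /horner_eval 4!mxE !hornerE.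
have Mev : map_mx (horner_eval 0) M = root_minor K s (diag_mx mu).
  rewrite map_root_minor Yev; apply/matrixP => r c; rewrite [LHS]mxE [RHS]mxE.
  congr (\tr (_ *m root_prod_mx _ _)).
    exact: map_horner_const.
  by rewrite -map_comp -[RHS]map_id; apply: eq_map => a /=; rewrite /horner_eval hornerC.
have Mevrc r c : (M r c).[0] = diag_mx (\row_r if r == j then 0 else g r r) r c.
  by rewrite -M0 -Mev [RHS]mxE.
(* Since [N] kills [diag_mx mu - (mu 0 i)%:M], the first factor contributes t N v, and the others
   may be taken at t = 0, where they act on [N] as the scalar [g i i]. *)
have Mjj : (M j j)^`().[0] = g i i * \tr (N *m v).
  have NY : map_mx polyC N *m (Y - (mu 0 i)%:P%:M) = 'X *: map_mx polyC (N *m v).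
    have N0 : N *m (diag_mx mu - (mu 0 i)%:M) = 0.
      rewrite -diag_const_mx -raddfB /= mul_mx_diag; apply/matrixP => a b; rewrite !mxE.
      have [->|/supN/andP[_ /memij ->]] := eqVneq (N a b) 0; first exact: mul0r.
      by rewrite subrr mulr0.
    rewrite /Y addrAC mulmxDr -scalemxAr -map_mxM.
    rewrite (_ : map_mx polyC (diag_mx mu) - _ = map_mx polyC (diag_mx mu - (mu 0 i)%:M)).
      by rewrite -map_mxM N0 map_mx0 add0r.
    by rewrite map_mxB map_scalar_mx.
  rewrite mxE /K /s eqxx /= mulmxA NY -scalemxAl linearZ /= derivM derivX mul1r.
  rewrite hornerD hornerM hornerX mul0r addr0 -/(horner_eval 0 _) -trace_map_mx map_mxM.
  rewrite map_root_prod_mx Yev map_horner_const.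
  have -> : map (horner_eval 0) (map polyC (s0 i)) = s0 i.
    by rewrite -map_comp -[RHS]map_id; apply: eq_map => a /=; rewrite /horner_eval hornerC.
  rewrite root_prod_mx_diag mxtrace_mulC mulmxA (_ : diag_mx _ *m N = g i i *: N).
    by rewrite -scalemxAl mxtraceZ.
  rewrite mul_diag_mx; apply/matrixP => a b; rewrite !mxE.
  have [->|/supN/andP[/memij -> _]] := eqVneq (N a b) 0; first by rewrite !mulr0.
  by rewrite /g /s (negbTE ij).
have := Tv _ (minor_vanishes K s).
rewrite tangent_line -/Y mmap_minor -/M (@deriv_det_diag _ _ _ j) => [|r c rc|]; last 2 first.
- by rewrite Mevrc mxE (negbTE rc) mulr0n.
- by rewrite Mevrc !mxE eqxx mul0rn.
move/eqP; rewrite Mjj -mulrA mulf_eq0 (negbTE (gnz _ ij)) /= mulf_eq0 => /orP[/eqP //|].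
rewrite prodf_seq_eq0 => /hasP[r _ /= /andP[rj]].
by rewrite Mevrc !mxE eqxx mulr1n (negbTE rj) (negbTE (gnz _ rj)).
Qed.
End Minors.

(** * Generic spectra *)

(** A symmetric polynomial is a polynomial in the elementary ones; at the eigenvalues these are, up
    to sign, the coefficients of the characteristic polynomial, hence polynomials in the matrix
    entries. *)
Lemma symmetric_spectral_mpoly (F : fieldType) (n : nat) (H : {mpoly F[n]}) :
  H \is symmetric -> exists g : {mpoly F[n * n]}, forall (Q : 'M[F]_n) (l : 'rV[F]_n),
    Q^T *m Q = 1%:M -> g.@[coords (Q^T *m diag_mx l *m Q)] = H.@[fun k => l 0 k].
Proof.
move=> /sym_fundamental[t [<- _]].
pose c (i : 'I_n) : {mpoly F[n * n]} :=
  (-1) ^+ i.+1 * (char_poly (generic_mx F n))`_(n - i.+1).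
exists (mmap (@mpolyC _ F) c t) => Q l QQ.
set A := Q^T *m _ *m Q.
rewrite (rmorph_mmap (meval (coords A))) comp_mpoly_meval; apply: eq_mmap => [a|i] /=.
  exact: mevalC.
rewrite tnth_map tnth_ord_tuple /c rmorphM rmorph_sign -coef_map map_char_poly map_generic_mx.
rewrite char_poly_orth //.
have := mroots_coeff [tuple l 0 k | k < n] (Ordinal (ltn_ord i : (i.+1 < n.+1)%N)).
rewrite /= big_map enumT => ->; rewrite mulrA -exprMn mulrNN mulr1 expr1n mul1r.
by apply: meval_eq => k; rewrite tnth_map tnth_ord_tuple.
Qed.

Section Generic.
Variables (R : realType) (n : nat).

(** The second clause keeps each midpoint of two eigenvalues away from the remaining ones, so that
    [Lambda_ij] has a single double eigenvalue. *)
Definition generic_diag (l : 'rV[R]_n) : Prop :=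
  (forall i j : 'I_n, i != j -> l 0 i != l 0 j) /\
  (forall i j k : 'I_n, i != j -> i != k -> j != k -> l 0 i + l 0 j != 2 * l 0 k).

Definition generic_diag_mpoly : {mpoly R[n]} :=
  (\prod_(ij : 'I_n * 'I_n | ij.1 != ij.2) ('X_(ij.1) - 'X_(ij.2))) *
  (\prod_(ijk : 'I_n * 'I_n * 'I_n |
      [&& ijk.1.1 != ijk.1.2, ijk.1.1 != ijk.2 & ijk.1.2 != ijk.2])
     ('X_(ijk.1.1) + 'X_(ijk.1.2) - 2 *: 'X_(ijk.2))).

Lemma generic_diag_mpoly_neq0 : generic_diag_mpoly != 0.
Proof.
apply: mulf_neq0; apply/prodf_neq0.
  case=> i j /= ij; apply: contraTneq isT => /(congr1 (mcoeff U_(i))).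
  rewrite mcoeffB !mcoeffXU eqxx eq_sym (negbTE ij) mcoeff0 subr0 => /eqP.
  by rewrite oner_eq0.
case=> -[i j] k /= /and3P[ij ik jk]; apply: contraTneq isT => /(congr1 (mcoeff U_(i))).
rewrite mcoeffB mcoeffD mcoeffZ !mcoeffXU eqxx !(eq_sym _ i) (negbTE ij) (negbTE ik) mcoeff0.
by rewrite mulr0 subr0 addr0 => /eqP; rewrite oner_eq0.
Qed.

Lemma generic_diag_mpolyP (l : 'rV[R]_n) :
  generic_diag_mpoly.@[fun k => l 0 k] != 0 -> generic_diag l.
Proof.
rewrite mevalM mulf_eq0 negb_or !rmorph_prod /= => /andP[/prodf_neq0 nz1 /prodf_neq0 nz2].
split=> [i j ij|i j k ij ik jk].
  by have /= := nz1 (i, j) ij; rewrite mevalB !mevalXU subr_eq0.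
have /= := nz2 (i, j, k); rewrite ij ik jk => /(_ isT).
by rewrite mevalB mevalD mevalZ !mevalXU subr_eq0.
Qed.

(* Multiplying all the permuted copies makes the polynomial symmetric, hence a polynomial
   in the coefficients of the characteristic polynomial. *)
Lemma generic_spectrum : exists g : {mpoly R[n * n]},
  (exists A0 : 'M[R]_n, A0^T = A0 /\ g.@[coords A0] != 0) /\
  forall (Q : 'M[R]_n) (l : 'rV[R]_n), Q^T *m Q = 1%:M ->
    g.@[coords (Q^T *m diag_mx l *m Q)] != 0 -> generic_diag l.
Proof.
pose H : {mpoly R[n]} := \prod_(s : {perm 'I_n}) msym s generic_diag_mpoly.
have symH : H \is symmetric.
  apply/issymP => s; rewrite /H rmorph_prod /= [RHS](reindex_inj (mulIg s)) /=.
  by apply: eq_bigr => u _; rewrite msymMm.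
have nzH : H != 0.
  apply/prodf_neq0 => s _; rewrite -(msym0 R s) (inj_eq (@inj_msym _ _ s)).
  exact: generic_diag_mpoly_neq0.
have [g gE] := symmetric_spectral_mpoly symH.
exists g; split.
  (* Being nonzero, [H] has a nonzero value at some natural point; the diagonal matrix of that point
     is the witness for [g]. *)
  have [[v nzv]|nov] := boolp.pselect (exists v : 'I_n -> nat, H.@[fun i => (v i)%:R] != 0).
    exists (diag_mx (\row_k (v k)%:R)); split; first exact: tr_diag_mx.
    have := gE 1%:M (\row_k (v k)%:R); rewrite trmx1 !mulmx1 mul1mx => -> //.
    by rewrite (@meval_eq _ _ _ (fun i => (v i)%:R)) // => k; rewrite mxE.
  case/negP: nzH; apply/eqP/mpoly_nat_eq0 => v; apply/eqP/negPn/negP => nzv.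
  by apply: nov; exists v.
move=> Q l QQ; rewrite gE // /H (bigD1 1%g) //= msym1m mevalM mulf_eq0 negb_or => /andP[nz _].
exact: generic_diag_mpolyP.
Qed.
End Generic.

(** * Dimension of the closure *)

Lemma meval_vars (F : comNzRingType) (N : nat) (S : {set 'I_N}) (p : {mpoly F[N]})
    (v w : 'I_N -> F) :
  (forall m, m \in msupp p -> forall k, k \notin S -> m k = 0%N) ->
  (forall k, k \in S -> v k = w k) -> p.@[v] = p.@[w].
Proof.
move=> pS vw; rewrite !mevalE; apply: eq_big_seq => m mp; congr (_ * _).
apply: eq_bigr => k _; have [/vw -> //|kS] := boolP (k \in S).
by rewrite (pS m mp k kS) !expr0.
Qed.

(** A test by substitution, usable on entries of matrix expressions: setting the variables outside
    [S] to zero leaves the polynomial unchanged. *)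
Lemma msupp_restrict_vars (F : comNzRingType) (N : nat) (S : {set 'I_N}) (q : {mpoly F[N]}) :
  mmap (@mpolyC N F) (fun k => if k \in S then 'X_k else 0) q = q ->
  forall m, m \in msupp q -> forall k, k \notin S -> m k = 0%N.
Proof.
move=> qE m; rewrite mcoeff_msupp -qE => mq k kS; apply/eqP; apply: contraNT mq => mk.
rewrite /mmap raddf_sum /= big1 // => m' _.
rewrite mul_mpolyC mcoeffZ /mmap1.
have [/existsP[k' /andP[k'S m'k']]|nex] := boolP [exists k', (k' \notin S) && (m' k' != 0%N)].
  by rewrite (bigD1 k') //= (negbTE k'S) expr0n (negbTE m'k') mul0r mcoeff0 mulr0.
rewrite (_ : \prod_i _ = 'X_[m']); last first.
  rewrite mpolyXE_id; apply: eq_bigr => i _; have [//|iS] := boolP (i \in S).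
  move: nex; rewrite negb_exists => /forallP/(_ i); rewrite iS /= negbK => /eqP ->.
  by rewrite !expr0.
rewrite mcoeffX; have [mm|] := eqVneq m' m; last by rewrite mulr0.
by case/existsP: nex; exists k; rewrite kS mm.
Qed.

Definition mxidx (n : nat) (ab : 'I_n * 'I_n) : 'I_(n * n) := mxvec_index ab.1 ab.2.

Lemma coords_mxidx (T : Type) (n : nat) (X : 'M[T]_n) ab : coords X (mxidx ab) = X ab.1 ab.2.
Proof. exact: mxvecE. Qed.

Lemma mxidx_inj (n : nat) : injective (@mxidx n).
Proof.
move=> ab cd e; have := coords_mxidx (\matrix_(a, b) (a, b)) ab; rewrite e coords_mxidx !mxE.
by case: ab cd {e} => [a b] [c d] /=.
Qed.

Lemma generic_mxE (F : comNzRingType) (n : nat) (ab : 'I_n * 'I_n) :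
  generic_mx F n ab.1 ab.2 = 'X_(mxidx ab).
Proof. by rewrite !mxE. Qed.

Definition upper (n : nat) : {set 'I_n * 'I_n} :=
  [set ab : 'I_n * 'I_n | (ab.1 <= ab.2)%N].

(** Omits the positions (0,0) and (0,1). This index set serves both for the parameters bounding the
    dimension from above and for the independent coordinates bounding it from below. *)
Definition upper02 (n : nat) : {set 'I_n * 'I_n} :=
  [set ab : 'I_n * 'I_n in upper n | ~~ ((ab.1 == 0%N :> nat) && (ab.2 <= 1)%N)].

Lemma card_upper02 (m : nat) : #|upper02 m.+2| = (#|upper m.+2| - 2)%N.
Proof.
pose o : 'I_m.+2 := @Ordinal m.+2 1 isT.
have -> : upper02 m.+2 = upper m.+2 :\: [set (ord0, ord0); (ord0, o)].
  apply/setP => -[a b]; rewrite !inE /= !xpair_eqE andbC; congr (_ && _).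
  by rewrite -!val_eqE /= -andb_orr; congr (~~ (_ && _)); case: (b : nat) => [|[]].
rewrite cardsD (setIidPr _) ?cards2 //.
by apply/subsetP => -[a b]; rewrite !inE /= !xpair_eqE => /orP[] /andP[/eqP -> /eqP ->].
Qed.

Section UpperSym.
Variable B : comNzRingType.

Definition symup (k : nat) (Z : 'M[B]_k) : 'M[B]_k :=
  \matrix_(a, b) if (a <= b)%N then Z a b else Z b a.

Lemma symup_tr k (Z : 'M[B]_k) : (symup Z)^T = symup Z.
Proof.
apply/matrixP => a b; rewrite !mxE; by case: (ltngtP a b) => // /val_inj ->.
Qed.

Lemma symup_id k (Z : 'M[B]_k) : Z^T = Z -> symup Z = Z.
Proof.
by move=> ZT; apply/matrixP => a b; rewrite mxE; case: ifP => // _; rewrite -{1}ZT mxE.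
Qed.

Variable m : nat.

(** The dominant map of the overview, its parameters packed into one matrix: the upper right block
    gives W, the upper half of the lower right block gives P, and position (1,1) gives the
    eigenvalue. These are the positions of [upper02]. *)
Definition rank_param (Z : 'M[B]_(2 + m)) : 'M[B]_(2 + m) :=
  let V := row_mx (ursubmx Z)^T 1%:M in
  V^T *m symup (drsubmx Z) *m V + (Z (lshift m ord_max) (lshift m ord_max))%:M.

Lemma rank_param_ext (Z Z' : 'M[B]_(2 + m)) :
  (forall ab, ab \in upper02 (2 + m) -> Z ab.1 ab.2 = Z' ab.1 ab.2) ->
  rank_param Z = rank_param Z'.
Proof.
move=> ZZ; rewrite /rank_param.
have -> : ursubmx Z = ursubmx Z'.
  apply/matrixP => a b; rewrite !mxE; apply: (ZZ (_, _)); rewrite !inE /=.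
  by case: a => [[|[]]].
have -> : symup (drsubmx Z) = symup (drsubmx Z').
  apply/matrixP => a b; rewrite !mxE; case: (leqP a b) => ab.
    by apply: (ZZ (_, _)); rewrite !inE /= !add2n !ltnS ab.
  by apply: (ZZ (_, _)); rewrite !inE /= !add2n !ltnS (ltnW ab).
by rewrite (ZZ (lshift m ord_max, lshift m ord_max)) // !inE /=.
Qed.
End UpperSym.

Lemma map_symup (B B' : comNzRingType) (f : {rmorphism B -> B'}) (k : nat) (Z : 'M[B]_k) :
  map_mx f (symup Z) = symup (map_mx f Z).
Proof. by apply/matrixP => a b; rewrite !mxE; case: ifP. Qed.

Lemma map_rank_param (B B' : comNzRingType) (f : {rmorphism B -> B'}) (m : nat)
    (Z : 'M[B]_(2 + m)) :
  map_mx f (rank_param Z) = rank_param (map_mx f Z).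
Proof.
rewrite /rank_param map_mxD !map_mxM map_symup map_scalar_mx -map_trmx map_row_mx map_mx1.
by rewrite -map_trmx map_ursubmx map_drsubmx [map_mx f Z _ _]mxE.
Qed.

Section Dimension.
Variables (R : realType) (m : nat).
Local Notation C := (R : rcfType)[i].
Local Notation n := (2 + m)%N.
Implicit Types (p : {mpoly C[n * n]}).

(* The matrices in the image of rank_param are those for which the last m columns of Y are
   independent; the others are reached along the line Y + t [0 | 1]. *)
Lemma rank_param_dense p (Y : 'M[C]_(m, n)) (K : 'M[C]_m) (a : C) :
  K^T = K -> mmap (@mpolyC _ C) (coords (rank_param (generic_mx C n))) p = 0 ->
  p.@[coords (Y^T *m K *m Y + a%:M)] = 0.
Proof.
move=> KT p0.
have [J JE] : exists J : 'M[C]_(m, n), J = row_mx 0 1%:M by eexists.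
pose Yt : 'M[{poly C}]_(m, n) := map_mx polyC Y + 'X *: map_mx polyC J.
pose X : 'M[{poly C}]_n := Yt^T *m map_mx polyC K *m Yt + a%:P%:M.
pose P := mmap polyC (coords X) p.
pose D := \det (rsubmx Yt).
have YtE i k : Yt i k = (Y i k)%:P + 'X * (J i k)%:P by rewrite !mxE.
have evY t : map_mx (horner_eval t) Yt = Y + t *: J.
  by apply/matrixP => i j; rewrite [LHS]mxE /horner_eval !(mxE, hornerE).
have evX t : map_mx (horner_eval t) X = (Y + t *: J)^T *m K *m (Y + t *: J) + a%:M.
  rewrite map_mxD !map_mxM -map_trmx evY map_horner_const map_scalar_mx /=.
  by rewrite /horner_eval hornerC.
have nzD : D != 0.
  have -> : D = char_poly (- rsubmx Y).
    rewrite /D /char_poly /char_poly_mx; congr (\det _); apply/matrixP => i j.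
    rewrite [LHS]mxE YtE JE row_mxEr !mxE polyCN opprK addrC polyC_natr.
    by rewrite mulr_natr.
  exact/monic_neq0/char_poly_monic.
suff P0 : P = 0.
  have := horner_mmap X 0 p; rewrite -/P P0 horner0 evX scale0r addr0.
  by move=> <-.
(* The factor [D] absorbs the parameters at which the right block is singular. *)
suff : D * P = 0 by move/eqP; rewrite mulf_eq0 (negbTE nzD) => /eqP.
apply: poly_nat_roots => [i j /eqP|k]; first by rewrite eqr_nat => /eqP.
rewrite hornerM; set t : C := k%:R.
have [->|nzt] := eqVneq D.[t] 0; first exact: mul0r.
suff -> : P.[t] = 0 by rewrite mulr0.
rewrite horner_mmap evX.
set Z := Y + t *: J.
have uZ : rsubmx Z \in unitmx.
  by rewrite unitmxE unitfE /Z -evY -map_rsubmx det_map_mx.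
(* Factoring [Z] as its right block times [W | 1] moves that block into the middle matrix, which
   gives a preimage [G]. *)
pose W := invmx (rsubmx Z) *m lsubmx Z.
pose G : 'M[C]_n := block_mx a%:M W^T 0 ((rsubmx Z)^T *m K *m rsubmx Z).
have -> : Z^T *m K *m Z + a%:M = rank_param G.
  rewrite /rank_param block_mxKur block_mxKdr trmxK symup_id; last first.
    by rewrite !trmx_mul trmxK KT mulmxA.
  have -> : G (lshift m ord_max) (lshift m ord_max) = a.
    by rewrite /G block_mxEul mxE eqxx mulr1n.
  congr (_ + _).
  have {1 2}-> : Z = rsubmx Z *m row_mx W 1%:M.
    by rewrite mul_mx_row mulmx1 mulKVmx // hsubmxK.
  by rewrite trmx_mul !mulmxA.
have := meval_mmap (rank_param (generic_mx C n)) (coords G) p; rewrite p0 meval0.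
by rewrite map_rank_param map_generic_mx.
Qed.

Lemma in_Cdelta_perm (A : 'M[R]_n) : in_Cdelta A -> exists (Q : 'M[R]_n) (l : 'rV[R]_n),
  A = Q^T *m diag_mx l *m Q /\ Q^T *m Q = 1%:M /\ lsubmx l = const_mx (l 0 (lshift m 0)).
Proof.
case/in_CdeltaP => Q [l [i [j [QQ AE ij lij]]]].
pose o0 : 'I_n := lshift m 0; pose o1 : 'I_n := lshift m ord_max.
pose t : {perm 'I_n} := tperm o0 i.
(* [t] sends [o0] to [i]; the second transposition corrects the image of [o1] to [j] and fixes
   [i]. *)
pose s := (t * tperm (t o1) j)%g.
have o01 : o0 != o1 by [].
have t0 : t o0 = i by rewrite tpermL.
have s0 : s o0 = i.
  rewrite permM t0 tpermD //; last by rewrite eq_sym.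
  by rewrite -t0 (inj_eq perm_inj) eq_sym.
have s1 : s o1 = j by rewrite permM tpermL.
exists (row_perm s Q), (\row_k l 0 (s k)); split; last split.
- apply/matrixP => a b; rewrite AE -!mulmxA !mxE (reindex_inj (@perm_inj _ s)) /=.
  by apply: eq_bigr => k _; rewrite !mul_diag_mx !mxE.
- rewrite -QQ; apply/matrixP => a b; rewrite !mxE [RHS](reindex_inj (@perm_inj _ s)) /=.
  by apply: eq_bigr => k _; rewrite !mxE.
apply/rowP => k; rewrite !mxE.
have [->|->] : k = 0 \/ k = ord_max; first by case: k => [[|[]]] // ?; [left|right]; apply: val_inj.
  by [].
by rewrite -/o0 -/o1 s0 s1.
Qed.

(** With the repeated eigenvalue a in the first two positions, A - a is a congruence transform of a
    diagonal matrix by the last m rows of [Q], which is the form treated by [rank_param_dense]. *)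
Lemma rank_param_vanishes p :
  mmap (@mpolyC _ C) (coords (rank_param (generic_mx C n))) p = 0 -> vanishes_on_Cdelta p.
Proof.
move=> p0 A /in_Cdelta_perm[Q [l [-> [QQ ll]]]].
set a := l 0 _ in ll.
pose K := diag_mx (rsubmx l - const_mx a).
have -> : Q^T *m diag_mx l *m Q = (dsubmx Q)^T *m K *m dsubmx Q + a%:M.
  have -> : diag_mx l = block_mx 0 0 0 K + a%:M.
    rewrite -[in LHS](hsubmxK l) diag_mx_row ll /K raddfB /= !diag_const_mx scalar_mx_block.
    by rewrite add_block_mx !addr0 add0r subrK.
  rewrite mulmxDr mulmxDl mul_mx_scalar -scalemxAl QQ scalemx1; congr (_ + _).
  rewrite -{1 2}(vsubmxK Q) tr_col_mx mul_row_block mul_row_col.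
  by rewrite !(mulmx0, mul0mx, addr0, add0r).
rewrite /mxC map_mxD !map_mxM map_scalar_mx -map_trmx; apply: rank_param_dense => //.
by rewrite map_trmx tr_diag_mx.
Qed.

(** Pulled back by [rank_param], all coordinates are polynomials in the variables of [upper02], so
    any larger set of coordinates satisfies a relation on the variety. *)
Lemma alg_indep_vars_le (S : {set 'I_(n * n)}) : alg_indep_vars R S -> (#|S| <= #|upper02 n|)%N.
Proof.
move=> indS; rewrite leqNgt; apply/negP => lt.
pose S0 := @mxidx n @: upper02 n.
have cS0 : #|S0| = #|upper02 n| by rewrite card_imset //; exact: mxidx_inj.
have [||p [nzp pS p0]] := @mpoly_alg_dep C (n * n) (coords (rank_param (generic_mx C n))) S S0.
- move=> i; apply: msupp_restrict_vars.
  set h := fun k => _.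
  rewrite [LHS](map_coords (mmap (@mpolyC (n * n) C) h)) map_rank_param.
  rewrite (@rank_param_ext _ _ _ (generic_mx C n)) // => ab abS.
  rewrite [LHS]mxE !generic_mxE /= mmapX mmap1U /h.
  by rewrite imset_f.
- by rewrite cS0.
by case/eqP: nzp; apply: indS => //; apply: rank_param_vanishes.
Qed.
End Dimension.

(** * Lower bound for the dimension *)

Section LowerBound.
Variable R : realType.
Local Notation C := (R : rcfType)[i].

(* With lam the eigenvalue of an eigenvector u of M such that u_0 != 0, the first row of A is
   taken orthogonal to u, i.e. of the form w^T (M - lam); then A - lam = [w|1]^T (M - lam) [w|1]
   has corank two. *)
Lemma in_Cdelta_extend (m : nat) (Q : 'M[R]_m.+1) (l : 'rV[R]_m.+1) (r : 'I_m.+1 -> R)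
    (M := Q^T *m diag_mx l *m Q) :
  Q^T *m Q = 1%:M -> (forall i j, i != j -> l 0 i != l 0 j) ->
  exists A : 'M[R]_(1 + m.+1), [/\ in_Cdelta A, drsubmx A = M &
    forall b, b != 0 -> A (lshift m.+1 0) (rshift 1 b) = r b].
Proof.
move=> QQ l_inj.
have [k Qk] : exists k, Q k 0 != 0.
  apply/existsP; apply: contraT; rewrite negb_exists => /forallP Q0.
  have /matrixP/(_ 0 0) := QQ; rewrite !mxE eqxx mulr1n big1 => [/esym/eqP|k _].
    by rewrite oner_eq0.
  by have /negPn/eqP -> := Q0 k; rewrite mulr0.
(* The entry at 0, the free position (0,1) of [A], is solved so that [r'] is orthogonal to the
   eigenvector in row [k] of [Q]. *)
pose r' : 'cV[R]_m.+1 :=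
  \col_b if b == 0 then - (\sum_(c | c != 0) Q k c * r c) / Q k 0 else r b.
have Qr : (Q *m r') k 0 = 0.
  rewrite mxE (bigD1 0) //= mxE eqxx mulrCA divff // mulr1 addrC; apply/eqP.
  rewrite subr_eq0; apply/eqP; apply: eq_bigr => c c0.
  by rewrite mxE (negbTE c0).
pose lam := l 0 k.
pose D := diag_mx (\row_a (l 0 a - lam)).
have ME : M - lam%:M = Q^T *m D *m Q.
  have -> : D = diag_mx l - lam%:M by apply/matrixP => a b; rewrite !mxE -mulrnBl.
  by rewrite mulmxBr mulmxBl mul_mx_scalar -scalemxAl QQ scalemx1.
(* At [k] the inverse of 0 is 0 by convention, which is harmless because [Q *m r'] vanishes
   there. *)
pose w := Q^T *m (diag_mx (\row_a (l 0 a - lam)^-1) *m (Q *m r')).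
have Mw : (M - lam%:M) *m w = r'.
  rewrite ME /w -!mulmxA (mulmxA Q) (mulmx1C QQ) mul1mx.
  rewrite (mulmxA D) mulmx_diag.
  transitivity (Q^T *m (Q *m r')); last by rewrite mulmxA QQ mul1mx.
  congr (_ *m _); rewrite mul_diag_mx; apply/colP => a; rewrite [LHS]mxE ![(\row__ _) _ _]mxE.
  have [->|ak] := eqVneq a k; first by rewrite Qr mulr0.
  by rewrite divff ?mul1r // subr_eq0 l_inj.
have MT : (M - lam%:M)^T = M - lam%:M.
  by rewrite ME !trmx_mul trmxK tr_diag_mx mulmxA.
pose V : 'M[R]_(m.+1, 1 + m.+1) := row_mx w 1%:M.
pose A : 'M[R]_(1 + m.+1) := V^T *m (M - lam%:M) *m V + lam%:M.
have wM : w^T *m (M - lam%:M) = r'^T by rewrite -[in RHS]Mw [RHS]trmx_mul MT.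
have AE : A = block_mx (r'^T *m w + lam%:M) r'^T r' M.
  rewrite /A /V tr_row_mx trmx1 mul_col_mx mul1mx mul_col_row !mulmx1 wM Mw.
  by rewrite scalar_mx_block add_block_mx !addr0 subrK.
exists A; split.
- apply: (@in_Cdelta_rank _ _ _ lam).
    by rewrite /A linearD /= !trmx_mul trmxK MT tr_scalar_mx mulmxA.
  rewrite /A addrK addn2.
  suff : (\rank (V^T *m (M - lam%:M) *m V) < m.+1)%N by [].
  apply: leq_ltn_trans (mxrankM_maxl _ _) _.
  apply: leq_ltn_trans (mxrankM_maxr _ _) _.
  (* [M - lam%:M] kills row [k] of [Q], hence is singular; the larger size of [A] adds one more to
     the corank. *)
  rewrite ltn_neqAle rank_leq_row andbT; apply: contraNneq Qk => rk.
  have fM : row_free (M - lam%:M) by rewrite -row_leq_rank rk.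
  have : row k Q = 0.
    apply: (row_free_inj fM); rewrite mul0mx -row_mul ME !mulmxA (mulmx1C QQ) mul1mx.
    apply/rowP => a; rewrite mul_diag_mx !mxE subrr.
    by rewrite mul0r.
  by move/rowP/(_ 0); rewrite !mxE => ->.
- by rewrite AE block_mxKdr.
by move=> b b0; rewrite AE block_mxEur !mxE (negbTE b0).
Qed.

(** When the lower right block has simple spectrum, the prescribed [upper02] entries extend to a
    matrix with a repeated eigenvalue, so [p] vanishes there. The factor [H] takes care of the other
    blocks. *)
Lemma upper02_indep (m : nat) : alg_indep_vars R (@mxidx m.+2 @: upper02 m.+2).
Proof.
move=> p vp pS.
have [g [[M0 [symM0 gM0]] gP]] := generic_spectrum R m.+1.
pose N := (1 + m.+1)%N.
pose H : {mpoly C[N * N]} := mmap (@mpolyC (N * N) C \o real_complex R)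
  (coords (symup (drsubmx (generic_mx C N : 'M_(1 + m.+1))))) g.
have HE (Z : 'M[R]_(1 + m.+1)) :
    H.@[coords (mxC Z)] = real_complex R (g.@[coords (symup (drsubmx Z))]).
  rewrite (rmorph_mmap (meval (coords (mxC Z)))).
  rewrite [RHS](rmorph_mmap (real_complex R)).
  apply: eq_mmap => [c|k] /=; first exact: mevalC.
  rewrite [LHS](map_coords (meval (coords (mxC Z)))) [RHS](map_coords (real_complex R)).
  by rewrite !map_symup !map_drsubmx map_generic_mx.
have nzH : H != 0.
  apply: contraNneq gM0 => H0; have := HE (block_mx 0 0 0 M0); rewrite H0 meval0.
  by rewrite block_mxKdr symup_id // => -[] <-.
suff : p * H = 0 by move/eqP; rewrite mulf_eq0 (negbTE nzH) orbF => /eqP.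
apply: mpoly_nat_eq0 => w.
pose Z : 'M[R]_(1 + m.+1) := vec_mx (\row_k (w k)%:R).
have wE : (fun k => (w k)%:R) =1 coords (mxC Z).
  move=> k; rewrite /mxC -[RHS](map_coords (real_complex R)) /coords vec_mxK mxE.
  by rewrite rmorph_nat.
rewrite (meval_eq _ wE) mevalM HE.
have [->|gZ] := eqVneq (g.@[coords (symup (drsubmx Z))]) 0; first by rewrite mulr0.
have [Q [l [QQ ME]]] := real_spectral (symup_tr (drsubmx Z)).
have [|l_inj _] := gP Q l QQ; first by rewrite -ME.
have [A [dA drA rA]] := in_Cdelta_extend (fun b => Z (lshift m.+1 0) (rshift 1 b)) QQ l_inj.
suff -> : p.@[coords (mxC Z)] = 0 by rewrite mul0r.
rewrite -[RHS](vp A dA); apply: meval_vars pS _ => _ /imsetP[[a b] abU ->].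
rewrite !coords_mxidx /= [LHS]mxE [RHS]mxE; congr (real_complex R _).
move: abU; rewrite !inE /= => /andP[ab nab].
case: (split_ordP (a : 'I_(1 + m.+1))) ab nab => a' ->.
  case: (split_ordP (b : 'I_(1 + m.+1))) => b' ->; rewrite ord1 //= => _.
    by rewrite ord1.
  move=> b0; rewrite rA //; apply: contraNneq b0 => -> //.
case: (split_ordP (b : 'I_(1 + m.+1))) => b' -> /= ab _; first by rewrite ord1 in ab.
have := congr1 (fun M : 'M[R]_m.+1 => M a' b') drA; rewrite -ME ![symup _ _ _]mxE.
by rewrite (_ : (a' <= b')%N) // !mxE.
Qed.

Lemma XC_dim_upper (m : nat) : XC_dim R m.+2 (#|upper m.+2| - 2).
Proof.
rewrite -card_upper02; split=> [|S indS]; last exact: alg_indep_vars_le indS.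
exists (@mxidx m.+2 @: upper02 m.+2); split; last exact: upper02_indep.
by rewrite card_imset //; exact: mxidx_inj.
Qed.

Lemma XC_dim_ltn (n : nat) (i j : 'I_n) : (i < j)%N -> XC_dim R n (#|upper n| - 2).
Proof.
case: n i j => [[]//|[|m]] i j; first by rewrite !ord1.
by move=> _; exact: XC_dim_upper.
Qed.
End LowerBound.

(** * Critical points *)

Section CriticalPoints.
Variables (R : realType) (n : nat).
Local Notation C := (R : rcfType)[i].
Implicit Types (l : 'rV[R]_n) (mu : 'rV[C]_n) (x v : 'M[C]_n).

Lemma mxtrace_delta (F : comNzRingType) (a b : 'I_n) (Y : 'M[F]_n) :
  \tr (delta_mx a b *m Y) = Y b a.
Proof.
rewrite /mxtrace (bigD1 a) //= big1 => [|k ka]; rewrite mxE.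
  rewrite addr0 (bigD1 b) //= mxE !eqxx mul1r big1 ?addr0 // => c cb.
  by rewrite mxE (negbTE cb) andbF mul0r.
by apply: big1 => c _; rewrite mxE (negbTE ka) mul0r.
Qed.

(** The equations come from the test matrices [delta_mx j i] and [delta_mx i i - delta_mx j j]. *)
Lemma tangent_double_eigenE mu (i j : 'I_n) v : i != j -> mu 0 i = mu 0 j ->
  (forall k k', k != k' -> k != j -> k' != j -> mu 0 k != mu 0 k') ->
  tangent_XC (diag_mx mu) v -> [/\ v^T = v, v i j = 0 & v i i = v j j].
Proof.
move=> ij mij mu_inj Tv.
have trN (N : 'M[C]_n) : (forall a b, N a b != 0 -> (a \in [:: i; j]) && (b \in [:: i; j])) ->
    \tr N = 0 -> \tr (N *m v) = 0.
  by move=> supN tr0; apply: (@tangent_double_eigen _ _ mu i j).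
split; first exact: tangent_sym Tv.
- rewrite -mxtrace_delta; apply: trN => [a b|].
    rewrite mxE !inE; case: (eqVneq a j) => [->|_]; last by rewrite eqxx.
    by case: (eqVneq b i) => [->|_]; rewrite ?orbT // eqxx.
  by rewrite -[delta_mx _ _]mulmx1 mxtrace_delta mxE (negbTE ij).
have : \tr ((delta_mx i i - delta_mx j j) *m v) = 0.
  apply: trN => [a b|].
    rewrite !mxE !inE; case: (a == i); case: (b == i); case: (a == j); case: (b == j);
      by rewrite //= subr0 eqxx.
  rewrite raddfB /= -[delta_mx i i]mulmx1 -[delta_mx j j]mulmx1.
  by rewrite !mxtrace_delta !mxE !eqxx subrr.
by rewrite mulmxBl raddfB /= !mxtrace_delta => /eqP; rewrite subr_eq0 => /eqP.
Qed.

Lemma skewE_diag (F : comNzRingType) (mu : 'rV[F]_n) (a b : 'I_n) :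
  skewE F a b *m diag_mx mu - diag_mx mu *m skewE F a b =
  (mu 0 b - mu 0 a) *: (delta_mx a b + delta_mx b a).
Proof.
have dR c d : delta_mx c d *m diag_mx mu = mu 0 d *: delta_mx c d.
  rewrite mul_mx_diag; apply/matrixP => e f; rewrite !mxE mulrC.
  by have [->|] := eqVneq f d; rewrite // andbF !mulr0.
have dL c d : diag_mx mu *m delta_mx c d = mu 0 c *: delta_mx c d.
  rewrite mul_diag_mx; apply/matrixP => e f; rewrite !mxE.
  by have [->|] := eqVneq e c; rewrite // !mulr0.
by rewrite /skewE mulmxBl mulmxBr !dR !dL; apply/matrixP => e f; rewrite !mxE; ring.
Qed.

(** The two linear conditions determine a tangent vector from its entries in [P]; conversely,
    diagonal directions and commutators give tangent vectors dual to these entries. *)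
Lemma subspace_dim_tangent mu (i j : 'I_n) : (i < j)%N -> mu 0 i = mu 0 j ->
  (forall k k', k != k' -> k != j -> k' != j -> mu 0 k != mu 0 k') ->
  subspace_dim (tangent_XC (diag_mx mu)) (#|upper n| - 2).
Proof.
move=> ltij mij mu_inj.
have ij : i != j by rewrite -val_eqE /= ltn_eqF.
pose P := upper n :\: [set (i, j); (j, j)].
have PP a b : ((a, b) \in P) = [&& (a <= b)%N, (a, b) != (i, j) & (a, b) != (j, j)].
  by rewrite !inE /= negb_or andbC.
have <- : #|P| = (#|upper n| - 2)%N.
  rewrite cardsD (setIidPr _) ?cards2 ?xpair_eqE ?(negbTE ij) //.
  apply/subsetP => -[a b]; rewrite !inE /= !xpair_eqE.
  by case/orP => /andP[/eqP -> /eqP ->] //; exact: ltnW.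
(* The diagonal vector at [i] also carries a 1 at [j], as equality of these two entries demands. *)
pose E (ab : 'I_n * 'I_n) : 'M[C]_n :=
  if ab.1 == ab.2 then diag_mx (delta_mx 0 ab.1 + (ab.1 == i)%:R *: delta_mx 0 j)
  else delta_mx ab.1 ab.2 + delta_mx ab.2 ab.1.
have E_dual ab cd : ab \in P -> cd \in P -> E ab cd.1 cd.2 = (ab == cd)%:R.
  case: ab cd => [a b] [c d]; rewrite !PP !xpair_eqE /E /= => abP cdP.
  have [ab|nab] := eqVneq a b.
    rewrite -ab in abP *; rewrite !mxE eqxx /=.
    have [cd|ncd] := eqVneq c d; last first.
      rewrite mulr0n; have [ac|//] := eqVneq a c.
      by rewrite ac (negbTE ncd).
    rewrite -cd in cdP *; move: cdP; rewrite andbb => /and3P[_ _ cj].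
    by rewrite (negbTE cj) mulr0 addr0 mulr1n andbb eq_sym.
  rewrite !mxE; have [cd|ncd] := eqVneq c d.
    rewrite -cd ![_ == c]eq_sym !(andbC (c == b)) (_ : (c == a) && (c == b) = false) ?addr0 //.
    by apply/negP => /andP[/eqP ca /eqP cb]; case/eqP: nab; rewrite -ca -cb.
  rewrite [in RHS](eq_sym a) [in RHS](eq_sym b).
  rewrite (_ : (c == b) && (d == a) = false) ?addr0 //.
  apply/negP => /andP[/eqP cb /eqP da]; move: abP cdP => /and3P[ab _ _] /and3P[cd _ _].
  by case/eqP: nab; apply/val_inj/eqP; rewrite eqn_leq ab -cb -da.
split.
  exists (fun k : 'I_#|P| => E (enum_val k)); split=> [k|c e k].
    have := enum_valP k; case: (enum_val k) => [a b]; rewrite PP !xpair_eqE /E /=.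
    move=> /and3P[leab nij njj]; have [ab|nab] := eqVneq a b.
      rewrite -ab in njj *; rewrite andbb in njj.
      apply: (tangent_diag ij mij); rewrite !mxE eqxx /= (eq_sym j) (negbTE njj) eqxx mulr1.
      by rewrite (eq_sym i) (negbTE ij) mulr0 addr0 add0r.
    (* [(i, j)] is the only increasing pair with equal values, and it is excluded from [P]. *)
    have nz : mu 0 b - mu 0 a != 0.
      rewrite subr_eq0; have [bj|bj] := eqVneq b j.
        rewrite bj -mij; rewrite bj in nij nab; rewrite eqxx andbT in nij.
        by apply: mu_inj; rewrite // eq_sym.
      have [aj|aj] := eqVneq a j; last by apply: mu_inj; rewrite // eq_sym.
      rewrite aj -mij; apply: mu_inj => //; rewrite -val_eqE /= gtn_eqF //.
      by rewrite (leq_trans ltij) // -aj.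
    have := tangentZ (mu 0 b - mu 0 a)^-1 (tangent_skew nab (in_XC_diag ij mij)).
    by rewrite skewE_diag scalerA mulVf // scale1r.
  have := congr1 (fun M : 'M[C]_n => M (enum_val k).1 (enum_val k).2) e.
  rewrite summxE mxE (bigD1 k) //= big1 => [|k' k'k]; rewrite mxE E_dual ?enum_valP //.
    by rewrite eqxx mulr1 addr0.
  by rewrite (inj_eq enum_val_inj) (negbTE k'k) mulr0.
move=> d' B TB freeB.
pose M := \matrix_(a < d', k < #|P|) B a (enum_val k).1 (enum_val k).2.
suff : row_free M by rewrite -row_leq_rank => le; exact: leq_trans le (rank_leq_col M).
apply: inj_row_free => u uM; apply/rowP => a; rewrite mxE.
apply: (freeB (fun a => u 0 a)) a; set w := \sum_(a < d') _.
have TB3 a := tangent_double_eigenE ij mij mu_inj (TB a).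
have wT : w^T = w.
  by rewrite /w linear_sum /=; apply: eq_bigr => a _; rewrite linearZ /=; have [-> _ _] := TB3 a.
have wij : w i j = 0.
  by rewrite summxE big1 // => a _; rewrite mxE; have [_ -> _] := TB3 a; rewrite mulr0.
have wii : w i i = w j j.
  by rewrite !summxE; apply: eq_bigr => a _; rewrite !mxE; have [_ _ ->] := TB3 a.
have wP ab : ab \in P -> w ab.1 ab.2 = 0.
  move=> abP; have /rowP/(_ (enum_rank_in abP ab)) := uM; rewrite !mxE => e.
  rewrite -[RHS]e summxE; apply: eq_bigr => a _.
  by rewrite !mxE enum_rankK_in.
have wup (a b : 'I_n) : (a <= b)%N -> w a b = 0.
  move=> ab; have [[-> ->] //|nij] := eqVneq (a, b) (i, j).
  have [[-> ->]|njj] := eqVneq (a, b) (j, j); last by apply: (wP (a, b)); rewrite PP ab nij.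
  by rewrite -wii; apply: (wP (i, i)); rewrite PP leqnn !xpair_eqE (negbTE ij) andbF.
apply/matrixP => a b; rewrite [RHS]mxE; have [/wup //|/ltnW/wup ba] := leqP a b.
by rewrite -wT mxE.
Qed.
(** By cyclicity [x] is orthogonal to its commutator with [E]. For diagonal [D] and [E] a [skewE],
    the right side isolates off-diagonal entries of [x]. *)
Lemma mxtrace_comm_sub (F : comNzRingType) (D E x : 'M[F]_n) :
  \tr ((D - x) *m (E *m x - x *m E)) = - \tr ((E *m D - D *m E) *m x).
Proof.
have trx : \tr (x *m (E *m x - x *m E)) = 0.
  by rewrite mulmxBr raddfB /= (mulmxA x E) [\tr (_ *m _ *m x)]mxtrace_mulC subrr.
rewrite mulmxBl raddfB /= trx subr0 mulmxBr mulmxBl.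
rewrite [\tr (D *m (E *m x) - _)]raddfB [\tr (E *m D *m x - _)]raddfB /= opprB (mulmxA D E).
by rewrite (mulmxA D x) [\tr (_ *m E)]mxtrace_mulC (mulmxA E).
Qed.

Lemma Lambda_ij_double l (i j : 'I_n) : i != j -> generic_diag l ->
  (Lambda_ij l i j 0 i = Lambda_ij l i j 0 j) /\
  (forall k k', k != k' -> k != j -> k' != j -> Lambda_ij l i j 0 k != Lambda_ij l i j 0 k').
Proof.
move=> ij [l_inj l_mid]; split; first by rewrite !mxE !eqxx orbT.
have mid k : k != i -> k != j -> (l 0 i + l 0 j) / 2 != l 0 k.
  move=> ki kj; apply: contraNneq (l_mid i j k ij _ _) => [<-||]; try by rewrite eq_sym.
  by rewrite mulrC divfK // pnatr_eq0.
move=> k k' kk' kj k'j; rewrite !mxE (negbTE kj) (negbTE k'j) !orbF.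
have [ki|ki] := eqVneq k i; have [k'i|k'i] := eqVneq k' i.
- by rewrite ki k'i eqxx in kk'.
- exact: mid.
- by rewrite eq_sym mid.
exact: l_inj.
Qed.

Lemma ED_critical_diag l x : generic_diag l ->
  ED_critical (diag_mx l) x <->
  exists i j : 'I_n, (i < j)%N /\ x = mxC (diag_mx (Lambda_ij l i j)).
Proof.
move=> lgen; have [l_inj _] := lgen.
pose lc := map_mx (real_complex R) l.
have lcE k : lc 0 k = real_complex R (l 0 k) by rewrite mxE.
split=> [[[inx _] orthx]|[i [j [ltij ->]]]].
  have xT := in_XC_sym inx.
  (* Orthogonality to the commutator direction gives 2 (l_b - l_a) x_ab = 0 up to sign. *)
  have x_diag a b : a != b -> x a b = 0.
    move=> ab; have := orthx _ (tangent_skew ab inx).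
    have -> : (mxC (diag_mx l) - x)^T = diag_mx lc - x.
      by rewrite mxC_diag [LHS]raddfB /= tr_diag_mx xT.
    rewrite mxtrace_comm_sub skewE_diag -scalemxAl mxtraceZ mulmxDl mxtraceD !mxtrace_delta.
    have -> : x b a = x a b by rewrite -[in LHS]xT mxE.
    move/eqP; rewrite oppr_eq0 mulf_eq0 subr_eq0 !lcE.
    have lba : l 0 b != l 0 a by apply: l_inj; rewrite eq_sym.
    rewrite (inj_eq (fmorph_inj _)) (negbTE lba) /= -mulr2n mulrn_eq0 /=.
    by move/eqP.
  pose mu := \row_k x k k.
  have xE : x = diag_mx mu.
    apply/matrixP => a b; rewrite !mxE; have [->|ab] := eqVneq a b; first by rewrite mulr1n.
    by rewrite mulr0n x_diag.
  have [i [j [ltij mij]]] : exists i j : 'I_n, (i < j)%N /\ mu 0 i = mu 0 j.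
    have [|i [j [ij mij]]] := @in_XC_diag_eq _ _ mu; first by rewrite -xE.
    case: (ltngtP i j) => [lt|gt|/val_inj e]; [by exists i, j|by exists j, i|].
    by rewrite e eqxx in ij.
  have ij : i != j by rewrite -val_eqE /= ltn_eqF.
  have orthd (d : 'rV[C]_n) : d 0 i = d 0 j -> \sum_k (lc 0 k - mu 0 k) * d 0 k = 0.
    move=> dij; rewrite -[RHS](orthx (diag_mx d)); last first.
      by rewrite xE; apply: tangent_diag mij dij.
    rewrite mxtrace_mul_diag; apply: eq_bigr => k _.
    by rewrite xE mxC_diag -raddfB /= tr_diag_mx !mxE eqxx mulr1n.
  have mu_k k : k != i -> k != j -> mu 0 k = lc 0 k.
    move=> ki kj.
    have dk : (delta_mx 0 k : 'rV[C]_n) 0 i = (delta_mx 0 k : 'rV[C]_n) 0 j.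
      by rewrite !mxE !(eq_sym _ k) (negbTE ki) (negbTE kj).
    have := orthd _ dk; rewrite (bigD1 k) //= big1 => [|c ck]; last first.
      by rewrite [delta_mx _ _ _ _]mxE (negbTE ck) andbF mulr0.
    rewrite [delta_mx _ _ _ _]mxE !eqxx mulr1 addr0 => /eqP; rewrite subr_eq0 => /eqP.
    by move=> ->.
  (* The test direction is the indicator of [i] and [j]: the common value is the mean of the two
     eigenvalues. *)
  have mu_i : mu 0 i = (lc 0 i + lc 0 j) / 2.
    pose d : 'rV[C]_n := \row_k ((k == i) || (k == j))%:R.
    have dE k : d 0 k = ((k == i) || (k == j))%:R by rewrite mxE.
    have dij : d 0 i = d 0 j by rewrite !dE !eqxx orbT.
    have := orthd _ dij.
    rewrite (bigD1 i) //= (bigD1 j) 1?eq_sym //= big1 => [|c /andP[ci cj]]; last first.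
      by rewrite dE (negbTE ci) (negbTE cj) mulr0.
    rewrite !dE !eqxx orbT /= addr0 !mulr1 -mij => e.
    suff : 2 * mu 0 i = lc 0 i + lc 0 j by move=> <-; rewrite [2 * _]mulrC mulfK // pnatr_eq0.
    apply/esym/eqP; rewrite -subr_eq0 -[X in _ == X]e; apply/eqP; ring.
  exists i, j; split=> //; rewrite xE mxC_diag; congr diag_mx; apply/rowP => k.
  rewrite [RHS]mxE [X in real_complex R X]mxE.
  have [ki|ki] := eqVneq k i; last have [kj|kj] := eqVneq k j.
  - by rewrite ki mu_i !lcE rmorphM rmorphD fmorphV rmorph_nat.
  - by rewrite kj -mij mu_i !lcE rmorphM rmorphD fmorphV rmorph_nat.
  by rewrite mu_k // lcE.
have ij : i != j by rewrite -val_eqE /= ltn_eqF.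
have [Lij L_inj] := Lambda_ij_double ij lgen.
set L := Lambda_ij l i j in Lij L_inj *.
pose mu := map_mx (real_complex R) L.
have muE k : mu 0 k = real_complex R (L 0 k) by rewrite [LHS]mxE.
have mij : mu 0 i = mu 0 j by rewrite !muE Lij.
have mu_inj k k' : k != k' -> k != j -> k' != j -> mu 0 k != mu 0 k'.
  move=> kk' kj k'j; rewrite !muE (inj_eq (fmorph_inj _)); exact: L_inj.
(* Smoothness holds because the tangent space and the variety both have dimension
   [#|upper n| - 2]. *)
rewrite mxC_diag -/mu; split; first split; first exact: in_XC_diag mij.
  exists (#|upper n| - 2)%N; split; last exact: (subspace_dim_tangent ltij mij mu_inj).
  exact: XC_dim_ltn ltij.
move=> v Tv; have [_ _ vij] := tangent_double_eigenE ij mij mu_inj Tv.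
rewrite mxC_diag -raddfB /= tr_diag_mx mxtrace_mulC mxtrace_mul_diag.
rewrite (bigD1 i) //= (bigD1 j) 1?eq_sym //= big1 => [|k /andP[ki kj]]; last first.
  by rewrite !mxE (negbTE ki) (negbTE kj) subrr mulr0.
rewrite -vij addr0 -mulrDr !mxE !eqxx orbT /= -!rmorphB -rmorphD /=.
by rewrite (_ : _ + _ = 0) ?rmorph0 ?mulr0 //; field.
Qed.
End CriticalPoints.

Lemma card_ltn_pairs (n : nat) : #|[set ij : 'I_n * 'I_n | (ij.1 < ij.2)%N]| = 'C(n, 2).
Proof.
rewrite -bin2_sum big_mkord -sum1_card.
rewrite (eq_bigl (fun ij : 'I_n * 'I_n => true && (ij.1 < ij.2)%N)); last first.
  by move=> ij; rewrite inE.
rewrite -(pair_big_dep predT (fun i j : 'I_n => (i < j)%N) (fun _ _ => 1%N)) /=.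
rewrite (exchange_big_dep predT) //=; apply: eq_bigr => j _.
by rewrite (big_ord_narrow (ltnW (ltn_ord j))) sum1_card card_ord.
Qed.

(** * Passage from diagonal to arbitrary symmetric matrices *)

Section Spectral.
Variables (R : realType) (n : nat) (Q : 'M[R]_n) (l : 'rV[R]_n).
Local Notation C := (R : rcfType)[i].
Hypotheses (QQ : Q^T *m Q = 1%:M) (lgen : generic_diag l).

Lemma ED_critical_spectral (x : 'M[C]_n) :
  ED_critical (Q^T *m diag_mx l *m Q) x <->
  exists i j : 'I_n, (i < j)%N /\ x = mxC (Q^T *m diag_mx (Lambda_ij l i j) *m Q).
Proof.
have QQt : Q *m Q^T = 1%:M by apply: mulmx1C.
split=> [critx|[i [j [ltij ->]]]].
  have := ED_critical_conj QQt critx.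
  rewrite !mulmxA QQt mul1mx -mulmxA QQt mulmx1 => /(ED_critical_diag _ lgen).
  case=> i [j [ltij e]]; exists i, j; split=> //.
  rewrite !mxCM -e mxCT !mulmxA -mxCT -mxCM QQ mxC1 mul1mx -mulmxA -mxCM QQ mxC1.
  by rewrite mulmx1.
have crit : ED_critical (diag_mx l) (mxC (diag_mx (Lambda_ij l i j))).
  by apply/(ED_critical_diag _ lgen); exists i, j.
have := @ED_critical_conj _ _ Q^T _ _ _ crit.
by rewrite trmxK -mxCT trmxK -!mxCM; apply.
Qed.

(** Since the eigenvalues are distinct, the positions where [Lambda_ij] differs from [l] are exactly
    the two averaged ones, and the order determines the pair. *)
Lemma Lambda_ij_inj (i j i' j' : 'I_n) : (i < j)%N -> (i' < j')%N ->
  Q^T *m diag_mx (Lambda_ij l i j) *m Q = Q^T *m diag_mx (Lambda_ij l i' j') *m Q ->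
  i = i' /\ j = j'.
Proof.
move=> ltij ltij' e; have [l_inj _] := lgen.
have QQt : Q *m Q^T = 1%:M by apply: mulmx1C.
have eL : Lambda_ij l i j = Lambda_ij l i' j'.
  have /(congr1 (fun M => Q *m M *m Q^T)) := e.
  rewrite !mulmxA QQt !mul1mx -!mulmxA QQt !mulmx1 => /matrixP eD.
  by apply/rowP => k; have := eD k k; rewrite !mxE eqxx !mulr1n.
have moved (a b k : 'I_n) : (a < b)%N ->
    (Lambda_ij l a b 0 k != l 0 k) = (k == a) || (k == b).
  move=> ltab; rewrite mxE; case: ifP => [kab|_]; last by rewrite eqxx.
  have lab : l 0 a != l 0 b by apply: l_inj; rewrite -val_eqE /= ltn_eqF.
  case/orP: kab => /eqP ->; apply: contraNneq lab => h; apply/eqP; lra.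
have mem k : (k == i) || (k == j) = (k == i') || (k == j').
  by rewrite -!moved // eL.
have := mem j; have := mem i; rewrite !eqxx orbT /=.
case/esym/orP => /eqP ii /esym/orP[] /eqP jj; subst.
- by rewrite ltnn in ltij.
- by [].
- by have := ltn_trans ltij ltij'; rewrite ltnn.
- by rewrite ltnn in ltij.
Qed.
End Spectral.

Theorem theorem1p5 (R : realType) (n : nat) :
  generic_sym (fun A : 'M[R]_n =>
    forall (Cm : 'M[R]_n) (l : 'rV[R]_n),
      Cm^T *m Cm = 1%:M -> A = Cm^T *m diag_mx l *m Cm ->
      (forall x : 'M[(R : rcfType)[i]]_n,
         ED_critical A x <->
         exists i j : 'I_n, (i < j)%N /\
           x = mxC (Cm^T *m diag_mx (Lambda_ij l i j) *m Cm)) /\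
      (forall i j i' j' : 'I_n, (i < j)%N -> (i' < j')%N ->
         Cm^T *m diag_mx (Lambda_ij l i j) *m Cm =
         Cm^T *m diag_mx (Lambda_ij l i' j') *m Cm ->
         i = i' /\ j = j'))
  /\ EDdeg_is R n 'C(n, 2).
Proof.
have [g [nzg gP]] := generic_spectrum R n; split; exists g; split=> // A symA gA.
  move=> Q l QQ AE; have lgen : generic_diag l by apply: gP QQ _; rewrite -AE.
  split=> [x|i j i' j']; first by rewrite AE; exact: ED_critical_spectral.
  exact: Lambda_ij_inj.
have [Q [l [QQ AE]]] := real_spectral symA.
have lgen : generic_diag l by apply: gP QQ _; rewrite -AE.
pose pairs := [set ij : 'I_n * 'I_n | (ij.1 < ij.2)%N].
pose crit (ij : 'I_n * 'I_n) := mxC (Q^T *m diag_mx (Lambda_ij l ij.1 ij.2) *m Q).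
exists [seq crit ij | ij <- enum pairs]; split; last split.
- rewrite map_inj_in_uniq ?enum_uniq // => -[i j] [i' j'].
  rewrite !mem_enum !inE /= => ltij ltij' /mxC_inj.
  by case/(Lambda_ij_inj QQ lgen ltij ltij') => -> ->.
- by rewrite size_map -cardE card_ltn_pairs.
move=> x; rewrite AE; apply: (iff_trans (ED_critical_spectral QQ lgen x)).
split=> [[i [j [ltij ->]]]|/mapP[[i j]]].
  by apply/mapP; exists (i, j) => //; rewrite mem_enum inE.
by rewrite mem_enum inE /= => ltij ->; exists i, j.
Qed.
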